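(* Let $(Q,\mathfrak n,k)$ be a regular local ring with $k$ algebraically closed, let $I\subseteq\mathfrak n^2$ be an ideal generated by a $Q$-regular sequence of length $c$, and put $R=Q/I$ and $V=I/\mathfrak nI$. Let $W$ be a $k$-subspace of $V$. Let $J\subseteq I$ be an ideal generated by a regular sequence consisting of preimages in $I$ of a basis of $W$, and let $R'=Q/J$. Let $\varphi_J\colon J/\mathfrak nJ\to V$ be the map $f+\mathfrak nJ\mapsto f+\mathfrak nI$. Then for all finitely generated $R$-modules $M$ and $N$ (regarded also as $R'$-modules via $R'\to R$) we have $$\varphi_J\big(V_{R'}(M,N)\big)=V_R(M,N)\cap W .$$
   Context: For $(Q,\mathfrak n,k)$ regular local and an ideal $I\subseteq\mathfrak n^2$ generated by a regular sequence, with $R=Q/I$, $V=I/\mathfrak nI$, and $\overline f$ denoting the image in $V$ of $f\in I$, the support variety of a pair of finitely generated $R$-modules $(M,N)$ is the subset of $V$ $$V_R(M,N)=\{\overline f\in V\mid \operatorname{Ext}^i_{Q/(f)}(M,N)\neq 0\text{ for infinitely many } i\}\cup\{0\}.$$ For $\overline f\neq0$ the condition depends only on $\overline f$ and not on the choice of representative $f$. The variety $V_{R'}(M,N)\subseteq J/\mathfrak nJ$ is defined the same way, with $I$ replaced by $J$. Any family of preimages in $I$ of a basis of $W$ is a $Q$-regular sequence, and $\varphi_J$ is injective with image $W$. *)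

(* Defs.v *)
From HB Require Import structures.
From mathcomp Require Import all_boot all_algebra.
From mathcomp Require Import boolp classical_sets functions.
From mathcomp Require Import freeg.

Set Implicit Arguments.
Unset Strict Implicit.
Unset Printing Implicit Defensive.

Import GRing.Theory.
Local Open Scope ring_scope.
Local Open Scope quotient_scope.
Local Open Scope classical_set_scope.

Section Span.
Variables (S : pzRingType) (M : lmodType S).

Definition in_span (s : seq M) (x : M) : Prop :=
  exists a : 'I_(size s) -> S, x = \sum_(i < size s) a i *: s`_i.

Definition lin_indep (s : seq M) : Prop :=
  forall a : 'I_(size s) -> S,
    \sum_(i < size s) a i *: s`_i = 0 -> forall i, a i = 0.

Definition is_basis (W : submodClosed M) (s : seq M) : Prop :=
  lin_indep s /\ forall w : M, w \in W <-> in_span s w.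

Definition fin_gen : Prop := exists s : seq M, forall x : M, in_span s x.

End Span.

Arguments fin_gen {S} M.

Section Restriction.
Variables (S T : pzRingType) (phi : {rmorphism S -> T}) (M : lmodType T).

Definition restr : Type := let _ := phi in M.

HB.instance Definition _ := GRing.Zmodule.on restr.

Definition restr_scale (a : S) (x : restr) : restr := phi a *: (x : M).

Fact restr_scaleA a b x :
  restr_scale a (restr_scale b x) = restr_scale (a * b) x.
Proof. by rewrite /restr_scale rmorphM scalerA. Qed.

Fact restr_scale1 : left_id 1 restr_scale.
Proof. by move=> x; rewrite /restr_scale rmorph1 scale1r. Qed.

Fact restr_scaleDr : right_distributive restr_scale +%R.
Proof. by move=> a x y; rewrite /restr_scale scalerDr. Qed.

Fact restr_scaleDl x : {morph restr_scale^~ x : a b / a + b}.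
Proof. by move=> a b; rewrite /restr_scale rmorphD scalerDl. Qed.

HB.instance Definition _ := GRing.Zmodule_isLmodule.Build S restr
  restr_scaleA restr_scale1 restr_scaleDr restr_scaleDl.

End Restriction.

Section FreeResolution.
Variable S : nzRingType.

Section Syzygy.
Variable M : lmodType S.

Definition aug : {freeg M / S} -> M := fglift id.

Fact aug_is_linear : linear aug.
Proof.
pose aA := GRing.isZmodMorphism.Build _ _ aug (lift_is_additive id).
pose augA : {additive {freeg M / S} -> M} := HB.pack aug aA.
have augD x y : aug (x + y) = aug x + aug y by rewrite -[aug]/(augA : _ -> _) raddfD.
have aug_sum (r : seq M) F : aug (\sum_(x <- r) F x) = \sum_(x <- r) aug (F x).
  by rewrite -[aug]/(augA : _ -> _) raddf_sum.
move=> c x y; rewrite augD; congr (_ + _).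
rewrite -{2}[x]freeg_sumE -[c *: x]/(fgscale c x) /fgscale !aug_sum scaler_sumr.
by apply: eq_bigr => z _; rewrite /aug !liftU scalerA.
Qed.

HB.instance Definition _ :=
  GRing.isLinear.Build S {freeg M / S} M *:%R aug aug_is_linear.

Definition aug_ker : {pred {freeg M / S}} := [pred x | aug x == 0].

Fact aug_ker_submod : submod_closed aug_ker.
Proof.
split=> [|c x y]; first by rewrite inE linear0.
rewrite !inE => /eqP x0 /eqP y0; apply/eqP.
by rewrite aug_is_linear x0 y0 scaler0 addr0.
Qed.

HB.instance Definition _ :=
  GRing.isSubmodClosed.Build S {freeg M / S} aug_ker aug_ker_submod.

Record syz_type := Syz { syz_val : {freeg M / S}; _ : syz_val \in aug_ker }.

HB.instance Definition _ := [isSub for syz_val].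
HB.instance Definition _ := [Choice of syz_type by <:].
HB.instance Definition _ := [SubChoice_isSubLmodule of syz_type by <:].

End Syzygy.

(* The n-th term of the canonical free resolution of M is the free module
   on (the elements of) the n-th iterated syzygy. *)
Fixpoint syz (M : lmodType S) (n : nat) : lmodType S :=
  if n is n'.+1 then syz_type (syz M n') : lmodType S else M.

Definition res (M : lmodType S) (n : nat) : lmodType S :=
  {freeg (syz M n) / S}.

Definition res_d (M : lmodType S) (n : nat) (x : res M n.+1) : res M n :=
  syz_val (@aug (syz M n.+1) x).

Lemma res_exact (M : lmodType S) n (x : res M n.+1) :
  res_d x = 0 <-> exists y : res M n.+2, x = res_d y.
Proof.
split=> [dx0|[y ->]]; last by rewrite /res_d; case: (aug y) => z /= /eqP ->.
have x0 : aug x = 0 by apply/val_inj.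
have xk : x \in @aug_ker (syz M n.+1) by apply/eqP.
by exists << Syz xk >>; rewrite /res_d /aug liftU scale1r.
Qed.

End FreeResolution.

Section Ext.
Variables (S : nzRingType) (M N : lmodType S).

Definition cocycle (n : nat) : {pred (res M n -> N)} :=
  [pred u | `[< linear u /\ forall x, u (res_d x) = 0 >]].

Definition coboundary (n : nat) : (res M n -> N) -> Prop :=
  if n is n'.+1 then
    fun u => exists v : res M n' -> N, linear v /\ u = v \o @res_d S M n'
  else fun u => u = 0.

Fact cocycle_zmod n : zmod_closed (@cocycle n).
Proof.
split=> [|u v].
  by apply/asboolP; split=> // a x y; rewrite scaler0 addr0.
move=> /asboolP[lu u0] /asboolP[lv v0]; apply/asboolP; split=> [a x y|x].
  by rewrite !fctE lu lv scalerBr opprD addrACA.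
by rewrite !fctE u0 v0 subr0.
Qed.

HB.instance Definition _ n :=
  GRing.isZmodClosed.Build (res M n -> N) (@cocycle n) (cocycle_zmod n).

Record cocycle_type (n : nat) :=
  Cocycle { cocycle_val : res M n -> N; _ : cocycle_val \in @cocycle n }.

HB.instance Definition _ n := [isSub for @cocycle_val n].
HB.instance Definition _ n := [Choice of cocycle_type n by <:].
HB.instance Definition _ n :=
  [SubChoice_isSubZmodule of cocycle_type n by <:].

Definition cobord (n : nat) : {pred cocycle_type n} :=
  [pred u | `[< coboundary (cocycle_val u) >]].

Fact cobord_zmod n : zmod_closed (@cobord n).
Proof.
case: n => [|n]; split=> [|u v].
- exact/asboolP.
- by move=> /asboolP /= u0 /asboolP /= v0; apply/asboolP; rewrite /= u0 v0 subr0.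
- by apply/asboolP; exists 0; split=> // a x y; rewrite scaler0 addr0.
move=> /asboolP[u' [lu uE]] /asboolP[v' [lv vE]].
apply/asboolP; exists (u' - v'); split=> [a x y|].
  by rewrite !fctE lu lv scalerBr opprD addrACA.
by rewrite /= uE vE.
Qed.

HB.instance Definition _ n :=
  GRing.isZmodClosed.Build (cocycle_type n) (@cobord n) (cobord_zmod n).

Definition Ext (n : nat) : zmodType := Quotient.quot (@cobord n).

End Ext.

Section Ideals.
Variable Q : comNzRingType.

(* idealr bundles properness: idealr Q is the type of proper ideals of Q. *)

Definition ideal_gen (s : seq Q) (x : Q) : Prop := in_span (s : seq Q^o) x.

Definition generated_by (I : idealr Q) (s : seq Q) : Prop :=
  forall x, x \in I <-> ideal_gen s x.

Definition regular_seq (s : seq Q) : Prop :=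
  (forall i y, (i < size s)%N ->
     ideal_gen (take i s) (s`_i * y) -> ideal_gen (take i s) y)
  /\ ~ ideal_gen s 1.

Definition noetherian : Prop :=
  forall I : idealr Q, exists s : seq Q, generated_by I s.

Definition maximal (m : idealr Q) : Prop :=
  forall I : idealr Q, {subset m <= I} -> {subset I <= m}.

Definition local_ring (n : idealr Q) : Prop :=
  maximal n /\ forall m : idealr Q, maximal m -> m =i n.

Definition prime_chain (p : nat -> prime_idealr Q) (d : nat) : Prop :=
  forall i, (i < d)%N ->
    {subset p i <= p i.+1} /\ exists2 x, x \in p i.+1 & x \notin p i.

Definition krull_dim (d : nat) : Prop :=
  (exists p, prime_chain p d) /\ (forall p e, prime_chain p e -> (e <= d)%N).

Definition regular_local_ring (n : idealr Q) : Prop :=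
  [/\ noetherian, local_ring n &
      exists d (x : d.-tuple Q), krull_dim d /\ generated_by n x].

Section IdealModule.
Variable I : idealr Q.

Record ideal_elt :=
  IdealElt { ideal_val : Q; ideal_valP : ideal_val \in I }.

HB.instance Definition _ := [isSub for ideal_val].
HB.instance Definition _ := [Choice of ideal_elt by <:].
HB.instance Definition _ := [SubChoice_isSubZmodule of ideal_elt by <:].

Lemma ideal_val_sum r (F : 'I_r -> ideal_elt) :
  ideal_val (\sum_(i < r) F i) = \sum_(i < r) ideal_val (F i).
Proof. by rewrite -[ideal_val]/(\val : ideal_elt -> Q) raddf_sum. Qed.

Definition ideal_scale (a : Q) (x : ideal_elt) : ideal_elt :=
  IdealElt (idealMr a (ideal_valP x)).

Fact ideal_scaleA a b x :
  ideal_scale a (ideal_scale b x) = ideal_scale (a * b) x.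
Proof. by apply/val_inj; rewrite /= mulrA. Qed.

Fact ideal_scale1 : left_id 1 ideal_scale.
Proof. by move=> x; apply/val_inj; rewrite /= mul1r. Qed.

Fact ideal_scaleDr : right_distributive ideal_scale +%R.
Proof. by move=> a x y; apply/val_inj; rewrite /= mulrDr. Qed.

Fact ideal_scaleDl x : {morph ideal_scale^~ x : a b / a + b}.
Proof. by move=> a b; apply/val_inj; rewrite /= mulrDl. Qed.

HB.instance Definition _ := GRing.Zmodule_isLmodule.Build Q ideal_elt
  ideal_scaleA ideal_scale1 ideal_scaleDr ideal_scaleDl.

End IdealModule.

Section PrincipalIdeal.
Variables (I : idealr Q) (f : ideal_elt I).

(* The ideal (f) of Q; it is proper because f lies in the proper ideal I. *)
Definition princ : {pred Q} := [pred x | `[< exists a : Q, x = a * ideal_val f >]].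

Fact princ_sub : {subset princ <= I}.
Proof. by move=> x /asboolP[a ->]; exact/idealMr/ideal_valP. Qed.

Fact princ_idealr : idealr_closed princ.
Proof.
split=> [||a u v].
- by apply/asboolP; exists 0; rewrite mul0r.
- by apply/negP => /princ_sub; rewrite idealr1.
move=> /asboolP[b ->] /asboolP[c ->].
by apply/asboolP; exists (a * b + c); rewrite mulrDl mulrA.
Qed.

HB.instance Definition _ := isIdealr.Build Q princ princ_idealr.

End PrincipalIdeal.

Section QuotientMap.
Variables (A B : idealr Q) (AB : {subset A <= B}).

Definition quot_map (x : {ideal_quot A}) : {ideal_quot B} :=
  let _ := AB in \pi_({ideal_quot B}) (repr x).

Lemma quot_mapE (x : Q) :
  quot_map (\pi_({ideal_quot A}) x) = \pi_({ideal_quot B}) x.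
Proof.
apply/eqP; rewrite /quot_map -Quotient.idealrBE; apply: AB.
by rewrite Quotient.idealrBE reprK.
Qed.

Fact quot_map_zmod : zmod_morphism quot_map.
Proof.
by move=> x y; rewrite -[x]reprK -[y]reprK -rmorphB !quot_mapE rmorphB.
Qed.

Fact quot_map_monoid : monoid_morphism quot_map.
Proof.
split=> [|x y].
  by rewrite -(rmorph1 (\pi_({ideal_quot A}))) quot_mapE rmorph1.
by rewrite -[x]reprK -[y]reprK -rmorphM !quot_mapE rmorphM.
Qed.

HB.instance Definition _ := GRing.isZmodMorphism.Build
  {ideal_quot A} {ideal_quot B} quot_map quot_map_zmod.
HB.instance Definition _ := GRing.isMonoidMorphism.Build
  {ideal_quot A} {ideal_quot B} quot_map quot_map_monoid.

End QuotientMap.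

Section IdealProduct.
Variables (A : idealr Q) (M : lmodType Q).

(* Finite sums of products a *: y with a in A and y in B; it serves both as
   the product of two ideals (M := Q^o) and as A M (B := predT). *)
Definition ideal_mul (B : {pred M}) : {pred M} :=
  [pred x | `[< exists r (a : 'I_r -> Q) (y : 'I_r -> M),
      [/\ forall i, a i \in A, forall i, y i \in B
        & x = \sum_(i < r) a i *: y i] >]].

Fact ideal_mul_zmod B : zmod_closed (ideal_mul B).
Proof.
split=> [|u v].
  apply/asboolP; exists 0%N, (fun=> 0), (fun=> 0).
  by split=> [[]|[]|] //; rewrite big_ord0.
move=> /asboolP[r [a [y [aA yB ->]]]] /asboolP[s [b [z [bA zB ->]]]].
apply/asboolP; exists (r + s)%N,
  (fun i => match fintype.split i with inl j => a j | inr j => - b j end),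
  (fun i => match fintype.split i with inl j => y j | inr j => z j end).
split=> [i|i|].
- by case: (fintype.split i) => j; rewrite ?rpredN.
- by case: (fintype.split i).
rewrite big_split_ord /= -sumrN; congr (_ + _); apply: eq_bigr => i _.
  by rewrite (unsplitK (inl i)).
by rewrite (unsplitK (inr i)) scaleNr.
Qed.

HB.instance Definition _ B :=
  GRing.isZmodClosed.Build M (ideal_mul B) (ideal_mul_zmod B).

(* M/AM as a module over Q/A *)
Definition reduction : Type := Quotient.quot (ideal_mul predT).

HB.instance Definition _ := GRing.Zmodule.on reduction.

Definition class (x : M) : reduction :=
  \pi_(Quotient.quot (ideal_mul predT)) x.

Definition lift (v : reduction) : M :=
  repr (v : Quotient.quot (ideal_mul predT)).

Definition red_scale (a : {ideal_quot A}) (v : reduction) : reduction :=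
  class (repr a *: lift v).

Lemma liftK : cancel lift class.
Proof. by move=> v; rewrite /class /lift reprK. Qed.

Lemma classD x y : class (x + y) = class x + class y.
Proof. by rewrite /class; exact: raddfD. Qed.

Lemma class_eq x y : (class x == class y) = (x - y \in ideal_mul predT).
Proof. by rewrite Quotient.idealrBE. Qed.

Lemma ideal_mul_scale a x : a \in A -> a *: x \in ideal_mul predT.
Proof.
move=> aA; apply/asboolP; exists 1%N, (fun=> a), (fun=> x).
by split=> //; rewrite big_ord1.
Qed.

Lemma ideal_mulZ a x : x \in ideal_mul predT -> a *: x \in ideal_mul predT.
Proof.
move=> /asboolP[r [b [y [bA yB ->]]]].
apply/asboolP; exists r, (fun i => a * b i), y; split=> // [i|].
  exact: idealMr.
by rewrite scaler_sumr; apply: eq_bigr => i _; rewrite scalerA.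
Qed.

Lemma red_scaleE a x :
  red_scale (\pi_({ideal_quot A}) a) (class x) = class (a *: x).
Proof.
apply/eqP; rewrite /red_scale class_eq.
set b := repr _; set y := lift _.
have -> : b *: y - a *: x = (b - a) *: y + a *: (y - x).
  by rewrite scalerBl scalerBr addrA subrK.
rewrite rpredD //.
  by apply: ideal_mul_scale; rewrite Quotient.idealrBE reprK.
by apply: ideal_mulZ; rewrite -class_eq liftK.
Qed.

Fact red_scaleA a b v : red_scale a (red_scale b v) = red_scale (a * b) v.
Proof.
rewrite -[a]reprK -[b]reprK -[v]liftK.
move: (repr a) (repr b) (lift v) => {}a {}b {}v.
by rewrite -rmorphM (red_scaleE b v) !red_scaleE scalerA.
Qed.

Fact red_scale1 : left_id 1 red_scale.
Proof.
move=> v; rewrite -[v]liftK; move: (lift v) => {}v.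
by rewrite -(rmorph1 (\pi_({ideal_quot A}))) red_scaleE scale1r.
Qed.

Fact red_scaleDr : right_distributive red_scale +%R.
Proof.
move=> a v w; rewrite -[a]reprK -[v]liftK -[w]liftK.
move: (repr a) (lift v) (lift w) => {}a {}v {}w.
by rewrite -classD !red_scaleE scalerDr classD.
Qed.

Fact red_scaleDl v : {morph red_scale^~ v : a b / a + b}.
Proof.
move=> a b; rewrite -[a]reprK -[b]reprK -[v]liftK.
move: (repr a) (repr b) (lift v) => {}a {}b {}v.
by rewrite -rmorphD !red_scaleE scalerDl classD.
Qed.

HB.instance Definition _ :=
  GRing.Zmodule_isLmodule.Build {ideal_quot A} reduction
    red_scaleA red_scale1 red_scaleDr red_scaleDl.

End IdealProduct.

End Ideals.

Section SupportVariety.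
Variables (Q : comNzRingType) (n : idealr Q).

(* The vector space I/nI over the residue field Q/n *)
Definition cotan (I : idealr Q) : lmodType {ideal_quot n} :=
  reduction n (ideal_elt I).

Definition cls (I : idealr Q) (f : ideal_elt I) : cotan I := class n f.

Definition ideal_incl (J I : idealr Q) (JI : {subset J <= I})
  (f : ideal_elt J) : ideal_elt I := IdealElt (JI _ (ideal_valP f)).

Definition cotan_map (J I : idealr Q) (JI : {subset J <= I}) (v : cotan J) :
  cotan I := cls (ideal_incl JI (lift v)).

Lemma cotan_mapE (J I : idealr Q) (JI : {subset J <= I}) (f : ideal_elt J) :
  cotan_map JI (cls f) = cls (ideal_incl JI f).
Proof.
apply/eqP; rewrite /cotan_map /cls class_eq.
have: lift (cls f) - f \in ideal_mul n predT by rewrite -class_eq liftK.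
case/asboolP => r [a [y [an _ fE]]]; apply/asboolP.
exists r, a, (fun i => ideal_incl JI (y i)); split=> //.
apply/val_inj; have /= -> := congr1 val fE.
by rewrite !ideal_val_sum.
Qed.

(* M and N are regarded as modules over Q/(f) via Q/(f) -> Q/I. *)
Definition support_variety (I : idealr Q) (M N : lmodType {ideal_quot I}) :
    set (cotan I) :=
  [set v | exists f : ideal_elt I, v = cls f /\
    forall m : nat, exists i : nat, (m <= i)%N /\
      exists x : Ext (restr (quot_map (@princ_sub _ _ f)) M)
                     (restr (quot_map (@princ_sub _ _ f)) N) i, x != 0]
  `|` [set 0].

End SupportVariety.

Arguments support_variety {Q} n {I} M N.
Arguments cotan_map {Q} n {J I} JI v.

(* Main.v *)
Require Import Defs.
From HB Require Import structures.
From mathcomp Require Import all_boot all_algebra.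
From mathcomp Require Import boolp classical_sets functions.
From mathcomp Require Import freeg ring.

Set Implicit Arguments.
Unset Strict Implicit.
Unset Printing Implicit Defensive.

Import GRing.Theory.
Local Open Scope ring_scope.
Local Open Scope classical_set_scope.

(** Ext over Q/(f) depends on the ideal (f) and on M and N as Q-modules, but
    not on whether f is regarded as an element of J or of I
    ([infinite_ext_incl]).  Hence the image of the variety of R' lies in that of
    R, and it lies in W because J is generated by lifts of a basis of W.
    Conversely a nonzero vector of the intersection is the class of some f in I
    for which Ext over Q/(f) is infinite and the class of some f' in J, and one
    has to pass from f to f'.  The theorem thus rests on the independence of
    the representative ([infinite_ext_cls]): if f lies outside n I and f - f'
    lies in n I, then Ext over Q/(f) is infinite exactly when Ext over Q/(f')
    is.

    Fix a regular sequence that generates I.  Then f is a combination of it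
    with a unit coefficient, and f' has the same coefficients modulo n.
    Changing them one at a time, once f' is scaled by a unit to agree with f at
    a unit coefficient, reduces the claim to f' = f + x h with x in n
    and h an entry of the sequence, where f, h and f', h are regular sequences
    ([regular_pair]; entries of a regular sequence in a noetherian local ring
    may be permuted, by Nakayama).

    For this step take a resolution of M by finite free modules over Q/(f, h),
    given by matrices D over Q.  Then D D = f s + h t for two families of
    matrices s and t, the cohomology operators of Eisenbud.  Over Q/(f) one has
    D D = h t, and the block matrices with rows (D, - t) and (h, - D) form a
    free resolution of M ([cone_resolution]).  Since h kills N, Ext over Q/(f)
    vanishes in large degrees if and only if t acts bijectively on the
    cohomology of Hom(-, N) in large degrees ([cone_exact]).  Over Q/(f + x h) the same matrices satisfy
    D D = h (t - x s), so there the criterion is that t - x s acts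
    bijectively.  These cohomology modules are finitely generated over a
    noetherian local ring and x lies in its maximal ideal, so if t acts
    bijectively then t - x s does too, by Nakayama ([perturb_onto],
    [perturb_into]). *)

(** * Noetherian modules *)

Section NoetherianModules.
Variable Q : comNzRingType.
Implicit Types X Y Z : lmodType Q.

Definition submodule X (P : X -> Prop) :=
  P 0 /\ forall q x y, P x -> P y -> P (q *: x + y).

Definition noetherian_mod X :=
  forall P : X -> Prop, submodule P ->
    exists l : seq X, (forall x, x \in l -> P x) /\ forall x, P x -> in_span l x.

Lemma submodD X (P : X -> Prop) x y : submodule P -> P x -> P y -> P (x + y).
Proof. by move=> [_ h] Px Py; rewrite -[x]scale1r; apply: h. Qed.

Lemma submodZ X (P : X -> Prop) q x : submodule P -> P x -> P (q *: x).
Proof. by move=> [h0 h] Px; rewrite -[_ *: _]addr0; apply: h. Qed.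

Lemma submodN X (P : X -> Prop) x : submodule P -> P x -> P (- x).
Proof. by move=> h Px; rewrite -scaleN1r; apply: submodZ. Qed.

Lemma submodB X (P : X -> Prop) x y : submodule P -> P x -> P y -> P (x - y).
Proof. by move=> h Px Py; apply: submodD => //; apply: submodN. Qed.

Lemma submod_sum X (P : X -> Prop) n (F : 'I_n -> X) :
  submodule P -> (forall i, P (F i)) -> P (\sum_i F i).
Proof.
move=> hP hF; elim/big_ind: _ => //; first by case: hP.
by move=> x y; apply: submodD.
Qed.

Lemma span_submod X (l : seq X) : submodule (in_span l).
Proof.
split=> [|q x y [a ->] [b ->]].
  by exists (fun=> 0); rewrite big1 // => i _; rewrite scale0r.
exists (fun i => q * a i + b i).
rewrite scaler_sumr -big_split; apply: eq_bigr => i _ /=.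
by rewrite scalerDl scalerA.
Qed.

Lemma mem_span X (l : seq X) x : x \in l -> in_span l x.
Proof.
move=> xl; have il : (index x l < size l)%N by rewrite index_mem.
exists (fun i => (i == Ordinal il)%:R).
rewrite (bigD1 (Ordinal il)) //= eqxx scale1r nth_index // big1 ?addr0 // => i.
by move=> /negbTE ->; rewrite scale0r.
Qed.

Lemma span_min X (l : seq X) (P : X -> Prop) x :
  submodule P -> (forall y, y \in l -> P y) -> in_span l x -> P x.
Proof.
move=> hP hl [a ->]; apply: submod_sum => // i.
by apply: submodZ => //; apply/hl/mem_nth.
Qed.

Lemma span_sub X (l l' : seq X) x :
  {subset l <= l'} -> in_span l x -> in_span l' x.
Proof.
move=> ll'; apply: span_min; first exact: span_submod.
by move=> y /ll'; apply: mem_span.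
Qed.

Lemma linear_fun0 (R : pzRingType) (U V : lmodType R) (f : U -> V) :
  linear f -> f 0 = 0.
Proof. by move=> lf; have := lf (-1) 0 0; rewrite scaler0 add0r scaleN1r addNr. Qed.

Lemma linear_funD (R : pzRingType) (U V : lmodType R) (f : U -> V) x y :
  linear f -> f (x + y) = f x + f y.
Proof. by move=> lf; rewrite -[x]scale1r lf !scale1r. Qed.

Lemma linear_funZ (R : pzRingType) (U V : lmodType R) (f : U -> V) q x :
  linear f -> f (q *: x) = q *: f x.
Proof. by move=> lf; rewrite -[_ *: _]addr0 lf (linear_fun0 lf) addr0. Qed.

Lemma linear_funB (R : pzRingType) (U V : lmodType R) (f : U -> V) x y :
  linear f -> f (x - y) = f x - f y.
Proof. by move=> lf; rewrite addrC -scaleN1r lf scaleN1r addrC. Qed.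

Lemma linear_fun_sum (R : pzRingType) (U V : lmodType R) (f : U -> V)
    n (F : 'I_n -> U) :
  linear f -> f (\sum_i F i) = \sum_i f (F i).
Proof.
move=> lf; apply: (big_morph f) => [x y|]; last exact: linear_fun0.
exact: linear_funD.
Qed.

Lemma submod_preim X Y (f : X -> Y) (P : Y -> Prop) :
  linear f -> submodule P -> submodule (P \o f).
Proof.
move=> lf hP; split=> [|q x y Px Py] /=; last by rewrite lf; case: hP => _; apply.
by rewrite linear_fun0 //; case: hP.
Qed.

(** Ascending chain condition, in the form used below: in a sequence of
    elements some term is a combination of the earlier ones. *)
Lemma noetherian_seq X (y : nat -> X) :
  noetherian_mod X -> exists j, in_span (mkseq y j) (y j).
Proof.
move=> hX; pose P x := exists j, in_span (mkseq y j) x.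
have mono i j x : (i <= j)%N -> in_span (mkseq y i) x -> in_span (mkseq y j) x.
  move=> ij; apply: span_sub => z /mapP[k]; rewrite mem_iota => ki ->.
  by apply/map_f; rewrite mem_iota; apply: leq_trans ij.
have hP : submodule P.
  split=> [|q u v [i iu] [j jv]]; first by exists 0%N; case: (span_submod (mkseq y 0)).
  exists (maxn i j); case: (span_submod (mkseq y (maxn i j))) => _; apply.
    by apply: mono iu; apply: leq_maxl.
  by apply: mono jv; apply: leq_maxr.
have [l [lP Pl]] := hX P hP.
have [j hj] : exists j, forall x, x \in l -> in_span (mkseq y j) x.
  elim: l lP {Pl} => [|z l IH] lP; first by exists 0%N.
  have [x xl|j hj] := IH; first by apply: lP; rewrite inE xl orbT.
  have [i iz] := lP z (mem_head _ _).
  exists (maxn i j) => x; rewrite inE => /orP[/eqP ->|/hj].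
    by apply: mono iz; apply: leq_maxl.
  by apply: mono; apply: leq_maxr.
exists j; apply: (span_min (span_submod _) hj); apply: Pl.
by exists j.+1; apply: mem_span; apply: map_f; rewrite mem_iota /= add0n.
Qed.

Lemma noetherian_surj X Y (p : X -> Y) :
  linear p -> (forall y, exists x, p x = y) ->
  noetherian_mod X -> noetherian_mod Y.
Proof.
move=> lp sp hX P hP; have [l [lP Pl]] := hX _ (submod_preim lp hP).
exists (map p l); split=> [_ /mapP[x /lP Px ->] //|y].
have [x <-] := sp y => Py.
apply: (span_min (P := in_span (map p l) \o p) _ _ (Pl x Py)).
  exact: submod_preim lp (span_submod _).
by move=> z zl; apply: mem_span; apply: map_f.
Qed.

(** An extension of noetherian modules is noetherian; the kernel enters as
    part of the image of a noetherian module Z. *)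
Lemma noetherian_ext X Y Z (g : Z -> X) (f : X -> Y) :
  linear g -> linear f -> (forall x, f x = 0 -> exists z, g z = x) ->
  noetherian_mod Z -> noetherian_mod Y -> noetherian_mod X.
Proof.
move=> lg lf fg hZ hY P hP.
have hPZ := submod_preim lg hP.
have hPY : submodule (fun y => exists2 x, P x & y = f x).
  split=> [|q _ _ [u Pu ->] [v Pv ->]].
    by exists 0; [case: hP|rewrite linear_fun0].
  by exists (q *: u + v); [case: hP => _; apply|rewrite lf].
have [lz [lzP Plz]] := hZ _ hPZ; have [ly [lyP Ply]] := hY _ hPY.
have [lx [lxP flx]] : exists lx, (forall x, x \in lx -> P x) /\ ly = map f lx.
  elim: ly lyP {Ply} => [|y ly IH] lyP; first by exists [::].
  have [z zl|lx [lxP ->]] := IH; first by apply: lyP; rewrite inE zl orbT.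
  have [u Pu yu] := lyP y (mem_head _ _).
  exists (u :: lx); split; last by rewrite yu.
  by move=> x; rewrite inE => /orP[/eqP -> //|/lxP].
exists (map g lz ++ lx); split=> [x|x Px].
  by rewrite mem_cat => /orP[/mapP[z /lzP Pz ->]|/lxP].
have [w wl fw] : exists2 w, in_span lx w & f x = f w.
  have : in_span ly (f x) by apply: Ply; exists x.
  rewrite flx => fx.
  apply: (span_min (P := fun v => exists2 w, in_span lx w & v = f w) _ _ fx).
    split=> [|q _ _ [u Pu ->] [v Pv ->]].
      by exists 0; [case: (span_submod lx)|rewrite linear_fun0].
    by exists (q *: u + v); [case: (span_submod lx) => _; apply|rewrite lf].
  by move=> _ /mapP[u ul ->]; exists u => //; apply: mem_span.
have Pw : P w by apply: span_min wl.
have [|z gz] := fg (x - w); first by rewrite linear_funB // fw subrr.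
rewrite -[x](subrK w) -gz; apply: submodD; first exact: span_submod.
  apply: (span_sub (l := map g lz)) => [u|]; first by rewrite mem_cat => ->.
  have /Plz : P (g z) by rewrite gz; apply: submodB.
  move/(span_min (P := in_span (map g lz) \o g)); apply.
    exact: submod_preim lg (span_submod _).
  by move=> u ul; apply: mem_span; apply: map_f.
by apply: span_sub wl => u ul; rewrite mem_cat ul orbT.
Qed.

Lemma noetherian_fun Y r : noetherian_mod Y -> noetherian_mod ('I_r -> Y).
Proof.
move=> hY; elim: r => [|r IH].
  move=> P hP; exists [::]; split=> // x _.
  have -> : x = 0 by apply/funext => -[].
  by case: (span_submod (X := 'I_0 -> Y) [::]).
pose g (u : 'I_r -> Y) : 'I_r.+1 -> Y :=
  fun i => if unlift ord0 i is Some j then u j else 0.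
apply: (noetherian_ext (g := g) (f := fun u : 'I_r.+1 -> Y => u ord0)) IH hY => //.
  move=> q u v; apply/funext => i; rewrite /g !fctE.
  by case: unliftP => [j|] _ //; rewrite scaler0 addr0.
move=> x x0; exists (fun j => x (fintype.lift ord0 j)); apply/funext => i.
by rewrite /g; case: unliftP => [j ->|->] //; rewrite x0.
Qed.

Lemma noetherian_row r : noetherian_mod Q^o -> noetherian_mod 'rV[Q]_r.
Proof.
move=> hQ; have := @noetherian_fun Q^o r hQ.
apply: (@noetherian_surj _ _ (fun u : 'I_r -> Q^o => \row_j (u j))).
  by move=> q u v; apply/rowP => j; rewrite !mxE !fctE.
by move=> y; exists (fun j => y 0 j); apply/rowP => j; rewrite mxE.
Qed.

Lemma noetherian_fin_gen X : noetherian_mod Q^o -> fin_gen X -> noetherian_mod X.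
Proof.
move=> hQ [s hs]; have := @noetherian_fun Q^o (size s) hQ.
apply: (@noetherian_surj _ _ (fun a : 'I_(size s) -> Q^o => \sum_i (a i : Q) *: s`_i)).
  move=> q u v; rewrite scaler_sumr -big_split; apply: eq_bigr => i _ /=.
  by rewrite !fctE scalerDl scalerA.
by move=> y; have [a ->] := hs y; exists a.
Qed.

End NoetherianModules.

(** * Nakayama's lemma *)

Section Nakayama.
Variable Q : comNzRingType.

Definition in_jacobson (x : Q) := forall q, exists v, v * (1 - q * x) = 1.

(** A form of Nakayama's lemma with a single multiplier x.  Choosing
    repeatedly gives y_0, y_1, ... in L with y_j = x y_(j+1) modulo B.  By
    the chain condition some y_j is a combination of its predecessors, which
    are multiples of x y_j modulo B; so (1 - q x) y_j lies in B. *)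
Lemma nakayama (X : lmodType Q) (L B : X -> Prop) x :
  noetherian_mod X -> in_jacobson x -> submodule B ->
  (forall y, L y -> exists w, L w /\ B (y - x *: w)) ->
  forall y, L y -> B y.
Proof.
move=> hX hx hB hL y Ly.
have ex z : exists u, L z -> L u /\ B (z - x *: u).
  case: (pselect (L z)) => [/hL[u hu]|nL]; first by exists u.
  by exists 0 => /nL.
have [w hw] := choice ex.
have Ly_ j : L (iter j w y) by elim: j => //= j /hw[].
have step i k : B (iter i w y - x ^+ k *: iter (i + k) w y).
  elim: k => [|k IH]; first by rewrite expr0 scale1r addn0 subrr; case: hB.
  rewrite -[_ - _](subrKA (x ^+ k *: iter (i + k) w y)); apply: submodD => //.
  rewrite addnS exprSr -scalerA -scalerBr; apply: submodZ => //.
  by have [] := hw _ (Ly_ (i + k)%N).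
have [j] := noetherian_seq (fun j => iter j w y) hX.
set yj := iter j w y => yjs.
have [q Bq] : exists q, B (yj - (q * x) *: yj).
  move: yjs; move/(span_min (P := fun z => exists q, B (z - (q * x) *: yj))).
  apply=> [|z /mapP[i]].
    split=> [|a u v [q hq] [r hr]].
      by exists 0; rewrite mul0r scale0r subr0; case: hB.
    exists (a * q + r).
    have -> : a *: u + v - ((a * q + r) * x) *: yj =
       a *: (u - (q * x) *: yj) + (v - (r * x) *: yj).
      by rewrite mulrDl scalerDl scalerBr scalerA mulrA opprD addrACA.
    by case: hB => _; apply.
  (* y_i = x ^ (j - i) y_j modulo B, and j - i > 0 leaves one factor x *)
  rewrite mem_iota add0n => /andP[_ ij] ->; exists (x ^+ (j - i).-1).
  rewrite -exprSr prednK ?subn_gt0 //.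
  by have := step i (j - i)%N; rewrite subnKC // ltnW.
have [v hv] := hx q.
have Byj : B yj.
  rewrite -[yj]scale1r -hv -scalerA; apply: submodZ => //.
  by rewrite scalerBl scale1r.
have := step 0%N j; rewrite add0n => /submodD-/(_ (x ^+ j *: yj)).
by rewrite subrK; apply=> //; apply: submodZ.
Qed.

End Nakayama.

(** * Local rings *)

Section LocalRings.
Variable Q : comNzRingType.

Definition pred_ideal (P : Q -> Prop) : {pred Q} := [pred x | `[< P x >]].

Lemma pred_idealP (P : Q -> Prop) :
  @submodule Q Q^o P -> ~ P 1 -> exists I : idealr Q, forall x, x \in I <-> P x.
Proof.
move=> [P0 hP] nP1.
have cl : idealr_closed (pred_ideal P).
  split=> [||a u v /asboolP Pu /asboolP Pv]; first exact/asboolP.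
    by apply/asboolPn.
  exact/asboolP/(hP a).
pose c := isIdealr.Build Q (pred_ideal P) cl.
pose I : idealr Q := HB.pack (pred_ideal P) c.
by exists I => x; split=> /asboolP.
Qed.

Lemma ideal_submod (I : idealr Q) : @submodule Q Q^o (fun x => x \in I).
Proof.
split=> [|q x y xI yI]; first exact: rpred0.
by apply: rpredD => //; apply: idealMr.
Qed.

Lemma noetherian_ring : noetherian Q -> noetherian_mod Q^o.
Proof.
move=> hQ P hP; have [P1|nP1] := pselect (P 1).
  exists [:: 1]; split=> [x|x _]; first by rewrite inE => /eqP ->.
  by exists (fun=> x); rewrite big_ord1 /=  /GRing.scale /= mulr1.
have [I hI] := pred_idealP hP nP1; have [s hs] := hQ I.
exists s; split=> [x xs|x /hI /hs //].
by apply/hI/hs; apply: (@mem_span Q Q^o).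
Qed.

(** If no maximal ideal contained a, every proper ideal above a generated by
    finitely many elements could be enlarged forever. *)
Lemma in_maximal_ideal (a : Q) : noetherian Q -> ~ (exists v, v * a = 1) ->
  exists2 m : idealr Q, maximal m & a \in m.
Proof.
move=> hQ na; apply: contrapT => nm.
pose ok (l : seq Q^o) := a \in (l : seq Q) /\ ~ in_span l 1.
have ext l : exists y, ok l -> ok (y :: l) /\ ~ in_span l y.
  have [[al nl]|nok] := pselect (ok l); last by exists 0 => /nok.
  apply: contrapT => nex; apply: nm.
  have [m hm] := pred_idealP (span_submod l) nl.
  exists m; last by apply/hm/mem_span.
  move=> I mI x xI; apply: contrapT => xm; apply: nex; exists x => _.
  split; last by move=> /hm.
  split; first by rewrite inE al orbT.
  move=> /(@span_min Q Q^o _ (fun x => x \in I)) I1.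
  suff : 1 \in I by rewrite idealr1.
  apply: I1; first exact: ideal_submod.
  by move=> z; rewrite inE => /orP[/eqP -> //|zl]; apply/mI/hm/mem_span.
have [y hy] := choice ext.
pose c j := iter j (fun l => y l :: l) [:: a : Q^o].
have okc j : ok (c j).
  elim: j => [|j /hy[] //]; split; first exact: mem_head.
  by case=> b; rewrite big_ord1 /= => b1; apply: na; exists (b ord0).
have [j yj] := noetherian_seq (fun j => y (c j)) (noetherian_ring hQ).
apply: (proj2 (hy _ (okc j))); apply: span_sub yj => z /mapP[i].
rewrite mem_iota add0n => /andP[_ ij] -> {z}; elim: j ij => // j IH.
rewrite ltnS leq_eqVlt => /orP[/eqP ->|ij] /=; first exact: mem_head.
by rewrite in_cons IH ?orbT.
Qed.

Variable n : idealr Q.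
Hypotheses (noethQ : noetherian Q) (locQ : local_ring n).

Lemma local_unit a : a \notin n -> exists v, v * a = 1.
Proof.
move=> an; apply: contrapT => /(in_maximal_ideal noethQ)[m mm am].
by move: an; rewrite -(proj2 locQ _ mm) am.
Qed.

Lemma ideal_local (I : idealr Q) : {subset I <= n}.
Proof.
move=> x xI; apply: contraT => /local_unit[v v1].
have : 1 \in I by rewrite -v1; apply: idealMr.
by rewrite idealr1.
Qed.

Lemma local_jacobson x : x \in n -> in_jacobson x.
Proof.
move=> xn q; apply: local_unit; apply/negP => n1.
have : 1 \in n by rewrite -(subrK (q * x) 1) rpredD // idealMr.
by rewrite idealr1.
Qed.

End LocalRings.

(** * Regular sequences *)

Section RegularSequences.
Variable Q : comNzRingType.
Implicit Types (A : Q -> Prop) (l : seq Q).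

Local Notation ideal_pred := (@submodule Q Q^o).
Local Notation span := (@in_span Q Q^o).

Definition nonzerodivisor A x := forall y, A (x * y) -> A y.

(** The ideal A + (x). *)
Definition add_gen A x : Q -> Prop := fun y => exists q, A (y - q * x).

Fixpoint add_gens A l := if l is x :: l' then add_gens (add_gen A x) l' else A.

(** Regularity on Q/A, by recursion from the head, so that the order of the
    entries can be changed one transposition at a time. *)
Fixpoint regular_mod A l :=
  if l is x :: l' then nonzerodivisor A x /\ regular_mod (add_gen A x) l' else True.

Lemma idealD A x y : ideal_pred A -> A x -> A y -> A (x + y).
Proof. exact: (@submodD Q Q^o). Qed.

Lemma idealB A x y : ideal_pred A -> A x -> A y -> A (x - y).
Proof. exact: (@submodB Q Q^o). Qed.

Lemma idealM A q x : ideal_pred A -> A x -> A (q * x).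
Proof. exact: (@submodZ Q Q^o). Qed.

Lemma ideal_zero : ideal_pred (fun y => y = 0).
Proof. by split=> // q x y -> ->; rewrite scaler0 addr0. Qed.

Lemma add_gen_ideal A x : ideal_pred A -> ideal_pred (add_gen A x).
Proof.
move=> hA; split=> [|q y z [a ay] [b bz]].
  by exists 0; rewrite mul0r subr0; case: hA.
exists (q * a + b); have -> : q *: (y : Q^o) + z - (q * a + b) * x =
    q * (y - a * x) + (z - b * x) by rewrite /GRing.scale /=; ring.
by apply: idealD => //; apply: idealM.
Qed.

Lemma add_gen_sub A x y : ideal_pred A -> A y -> add_gen A x y.
Proof. by move=> hA Ay; exists 0; rewrite mul0r subr0. Qed.

Lemma add_gen_self A x : ideal_pred A -> add_gen A x x.
Proof. by move=> hA; exists 1; rewrite mul1r subrr; case: hA. Qed.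

Lemma add_genC A x y : add_gen (add_gen A x) y = add_gen (add_gen A y) x.
Proof.
by apply/funext => z; apply/propext; split=> -[p [q h]]; exists q, p; move: h;
  rewrite addrAC.
Qed.

Lemma add_gens_ideal A l : ideal_pred A -> ideal_pred (add_gens A l).
Proof. by elim: l A => //= x l IH A hA; apply/IH/add_gen_ideal. Qed.

Lemma add_gens_sub A l y : ideal_pred A -> A y -> add_gens A l y.
Proof.
elim: l A => //= x l IH A hA Ay.
by apply: IH; [apply: add_gen_ideal|apply: add_gen_sub].
Qed.

Lemma span_add_gens A l y : ideal_pred A -> span l y -> add_gens A l y.
Proof.
move=> hA h; apply: (@span_min Q Q^o l (add_gens A l) y _ _ h).
  exact: add_gens_ideal.
elim: l A hA {h} => //= x l IH A hA z; rewrite inE => /orP[/eqP ->|zl].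
  apply: add_gens_sub; first exact: add_gen_ideal.
  exact: add_gen_self.
by apply: IH => //; apply: add_gen_ideal.
Qed.

Lemma span_rcons l x : add_gen (span l) x = span (rcons l x).
Proof.
apply/funext => y; apply/propext; split=> [[q h]|].
  rewrite -[y](subrK (q * x)).
  apply: (idealD (span_submod _)).
    by apply: (@span_sub Q Q^o) h => z zl; rewrite mem_rcons inE zl orbT.
  apply: (idealM _ (span_submod _)).
  by apply: (@mem_span Q Q^o); rewrite mem_rcons mem_head.
move=> h; apply: (@span_min Q Q^o _ (add_gen (span l) x) _ _ _ h) => [|z].
  exact/add_gen_ideal/span_submod.
rewrite mem_rcons inE => /orP[/eqP ->|zl].
  exact/add_gen_self/span_submod.
by apply: add_gen_sub; [apply: span_submod|apply: (@mem_span Q Q^o)].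
Qed.

Lemma regular_seq_mod l : regular_seq l -> regular_mod (fun y => y = 0) l.
Proof.
move=> [hl _]; have -> : (fun y : Q => y = 0) = span [::].
  apply/funext => y; apply/propext; split=> [->|[a ->]]; last by rewrite big_ord0.
  by case: (@span_submod Q Q^o [::]).
have: forall p t, l = p ++ t -> regular_mod (span p) t; last by apply.
move=> p t; elim: t p => //= x t IH p lE; split.
  move=> y; have := hl (size p) y; rewrite lE nth_cat ltnn subnn /= take_size_cat //.
  by apply; rewrite size_cat /= addnS ltnS leq_addr.
by rewrite span_rcons; apply: IH; rewrite cat_rcons.
Qed.

Hypothesis noethQ : noetherian_mod Q^o.

(** The elements y with b y in A satisfy y = a y' modulo A with y' of the same
    kind; Nakayama puts them into A. *)
Lemma regular_swap A a b l : ideal_pred A -> in_jacobson a ->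
  regular_mod A [:: a, b & l] -> regular_mod A [:: b, a & l].
Proof.
move=> hA ja /= [ra [rb rl]]; split; last split; last by rewrite add_genC.
  move=> y Aby.
  apply: (nakayama (X := Q^o) (L := fun y => A (b * y)) noethQ ja hA) Aby => {}y Aby.
  have [q hq] := rb y (add_gen_sub a hA Aby).
  exists q; split; last by rewrite /GRing.scale /= mulrC.
  apply: ra; have -> : a * (b * q) = b * y - b * (y - q * a) by ring.
  by apply: idealB => //; apply: idealM.
move=> y [z hz]; have [|q hq] := rb z.
  exists y; have -> : b * z - y * a = - 1 * (a * y - z * b) by ring.
  exact: idealM.
exists q; apply: ra.
have -> : a * (y - q * b) = (a * y - z * b) + b * (z - q * a) by ring.
by apply: idealD => //; apply: idealM.
Qed.

Lemma regular_to_front A l1 x l2 : ideal_pred A ->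
  (forall y, y \in l1 -> in_jacobson y) ->
  regular_mod A (l1 ++ x :: l2) -> regular_mod A (x :: l1 ++ l2).
Proof.
elim: l1 A => // y l1 IH A hA jl /= [ry rl].
apply: regular_swap => //; first by apply: jl; rewrite mem_head.
split=> //; apply: IH rl; first exact: add_gen_ideal.
by move=> z zl; apply: jl; rewrite inE zl orbT.
Qed.

(** Modulo the remaining entries f is a unit multiple of y; the head is
    replaced after it has been moved past all of them. *)
Lemma regular_change_head A y l f u v : ideal_pred A ->
  (forall x, x \in y :: l -> in_jacobson x) -> v * u = 1 ->
  add_gens A l (f - u * y) -> regular_mod A (y :: l) -> regular_mod A (f :: l).
Proof.
move=> + + vu; elim: l A => [|x l IH] A hA jl /=.
  move=> fy [ry _]; split=> // z fz; apply: ry.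
  have -> : y * z = v * (f * z - (f - u * y) * z) + (1 - v * u) * (y * z) by ring.
  rewrite vu subrr mul0r addr0; apply: idealM => //; apply: idealB => //.
  by rewrite mulrC; apply: idealM.
move=> fy ryx; have jx : in_jacobson x by apply: jl; rewrite !inE eqxx orbT.
have jy : in_jacobson y by apply: jl; rewrite mem_head.
have /= [rx ryl] := regular_swap hA jy ryx.
apply: regular_swap => //; split=> //; apply: IH => //; first exact: add_gen_ideal.
by move=> z; rewrite inE => zl; apply: jl; rewrite !inE orbCA zl orbT.
Qed.

(** A combination f of a regular sequence with a unit coefficient at i0 can
    take the place of the entry i0; every other entry then follows f in some
    regular sequence. *)
Lemma regular_pair A (s : seq Q) (b : 'I_(size s) -> Q) (i0 k : 'I_(size s)) v :
  ideal_pred A -> (forall x, x \in s -> in_jacobson x) -> regular_mod A s ->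
  k != i0 -> v * b i0 = 1 ->
  exists r, regular_mod A [:: \sum_i b i * s`_i, s`_k & r].
Proof.
move=> hA js rs ki vb; set f := \sum_i _.
pose t := take i0 s ++ drop i0.+1 s.
have sE : s = take i0 s ++ s`_i0 :: drop i0.+1 s.
  by rewrite -drop_nth // cat_take_drop.
have ts : {subset t <= s}.
  by move=> x; rewrite mem_cat => /orP[/mem_take|/mem_drop].
have st (i : 'I_(size s)) : i != i0 -> s`_i \in t.
  rewrite neq_ltn mem_cat => /orP[ii|ii].
    by rewrite -(nth_take 0 ii) mem_nth // size_take ltn_ord.
  rewrite -{2}(subnKC ii) -nth_drop mem_nth ?orbT // size_drop.
  apply: ltn_sub2r; last exact: ltn_ord.
  exact: leq_ltn_trans ii (ltn_ord i).
have jt : forall x, x \in s`_i0 :: t -> in_jacobson x.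
  by move=> x; rewrite inE => /orP[/eqP ->|/ts/js //]; apply/js/mem_nth.
have rt : regular_mod A (s`_i0 :: t).
  apply: regular_to_front => //; last by rewrite -sE.
  by move=> x /mem_take/js.
have ft : regular_mod A (f :: t).
  apply: (regular_change_head (u := b i0) hA jt vb _ rt).
  apply: span_add_gens => //; rewrite /f (bigD1 i0) //= addrAC subrr add0r.
  elim/big_ind: _ => [|x y|i ii]; first by case: (@span_submod Q Q^o t).
    by apply: idealD; apply: span_submod.
  by apply: idealM; [apply: span_submod|apply/(@mem_span Q Q^o)/st].
case: ft (st k ki) (fun x xt => js x (ts x xt)) => rf.
move: (t) => u ru ku; case/splitPr: ku ru => r1 r2 ru ju.
exists (r1 ++ r2); split=> //; apply: regular_to_front ru.
  exact: add_gen_ideal.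
by move=> x xr; apply: ju; rewrite mem_cat xr.
Qed.

End RegularSequences.

(** * Free resolutions and Ext *)

Section Resolutions.
Variable S : nzRingType.
Implicit Types M N : lmodType S.

Definition lifting (F : lmodType S) := forall (X Y : lmodType S) (p : X -> Y) (g : F -> Y),
  linear p -> linear g -> (forall x, exists z, p z = g x) ->
  exists2 h : F -> X, linear h & forall x, p (h x) = g x.

Definition resolution M (X : nat -> lmodType S) (d : forall i, X i.+1 -> X i)
    (a : X 0%N -> M) :=
  [/\ [/\ forall i, lifting (X i), forall i, linear (d i) & linear a],
      forall m, exists x, a x = m,
      forall x, a x = 0 <-> exists y, x = d 0%N y
    & forall i x, d i x = 0 <-> exists y, x = d i.+1 y].

(** Vanishing of the cohomology of Hom(X, N) in degree i + 1. *)
Definition hom_exact N (X : nat -> lmodType S) (d : forall i, X i.+1 -> X i) i :=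
  forall u : X i.+1 -> N, linear u -> (forall x, u (d i.+1 x) = 0) ->
  exists2 w : X i -> N, linear w & forall x, u x = w (d i x).

Lemma linear_comp (X Y Z : lmodType S) (f : Y -> Z) (g : X -> Y) :
  linear f -> linear g -> linear (fun x => f (g x)).
Proof. by move=> lf lg a x y; rewrite lg lf. Qed.

Lemma linear_sub (X Y : lmodType S) (f g : X -> Y) :
  linear f -> linear g -> linear (fun x => f x - g x).
Proof. by move=> lf lg a x y; rewrite lf lg scalerBr opprD addrACA. Qed.

(** One step of the comparison theorem at a time: the maps between X and Y in
    two consecutive degrees and one homotopy are all that the next step
    uses, so no infinite family of maps has to be chosen. *)
Lemma comparison M (X Y : nat -> lmodType S)
    (dX : forall i, X i.+1 -> X i) (aX : X 0%N -> M)
    (dY : forall i, Y i.+1 -> Y i) (aY : Y 0%N -> M) :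
  resolution dX aX -> resolution dY aY -> forall i,
  exists (f : X i -> Y i) (f' : X i.+1 -> Y i.+1)
         (g : Y i -> X i) (g' : Y i.+1 -> X i.+1) (h : X i -> X i.+1),
  [/\ [/\ linear f, linear f', linear g, linear g' & linear h],
      forall x, dY i (f' x) = f (dX i x), forall y, dX i (g' y) = g (dY i y)
    & forall x, dX i (x - g' (f' x) - h (dX i x)) = 0].
Proof.
move=> [[pX lX laX] sX eX0 eX] [[pY lY laY] sY eY0 eY].
have ddX i x : dX i (dX i.+1 x) = 0 by apply/eX; exists x.
have ddY i y : dY i (dY i.+1 y) = 0 by apply/eY; exists y.
elim=> [|i [f [f' [g [g' [h [[lf lf' lg lg' lh] ff gg hh]]]]]]].
  have [f lf fE] := pX 0%N _ _ aY aX laY laX (fun x => sY (aX x)).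
  have [g lg gE] := pY 0%N _ _ aX aY laX laY (fun x => sX (aY x)).
  have [|f' lf' f'E] :=
      pX 1%N _ _ (dY 0%N) (fun x => f (dX 0%N x)) (lY _) (linear_comp lf (lX _)).
    move=> x; have /eY0[y ->] : aY (f (dX 0%N x)) = 0; last by exists y.
    by rewrite fE; apply/eX0; exists x.
  have [|g' lg' g'E] :=
      pY 1%N _ _ (dX 0%N) (fun x => g (dY 0%N x)) (lX _) (linear_comp lg (lY _)).
    move=> y; have /eX0[x ->] : aX (g (dY 0%N y)) = 0; last by exists x.
    by rewrite gE; apply/eY0; exists y.
  have lid : linear (fun x : X 0%N => x) by [].
  have [|h lh hE] := pX 0%N _ _ (dX 0%N) (fun x => x - g (f x)) (lX _)
                       (linear_sub lid (linear_comp lg lf)).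
    move=> x; have /eX0[y ->] : aX (x - g (f x)) = 0; last by exists y.
    by rewrite linear_funB // gE fE subrr.
  exists f, f', g, g', h; split=> // x.
   by rewrite !(linear_funB _ _ (lX _)) g'E f'E hE subrr.
have [|f'' lf'' f''E] :=
    pX i.+2 _ _ (dY i.+1) (fun x => f' (dX i.+1 x)) (lY _) (linear_comp lf' (lX _)).
  move=> x; have /eY[y ->] : dY i (f' (dX i.+1 x)) = 0; last by exists y.
  by rewrite ff ddX linear_fun0.
have [|g'' lg'' g''E] :=
    pY i.+2 _ _ (dX i.+1) (fun x => g' (dY i.+1 x)) (lX _) (linear_comp lg' (lY _)).
  move=> y; have /eX[x ->] : dX i (g' (dY i.+1 y)) = 0; last by exists x.
  by rewrite gg ddY linear_fun0.
have lid : linear (fun x : X i.+1 => x) by [].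
have [|h' lh' h'E] := pX i.+1 _ _ (dX i.+1) (fun x => x - g' (f' x) - h (dX i x)) (lX _)
    (linear_sub (linear_sub lid (linear_comp lg' lf')) (linear_comp lh (lX _))).
  by move=> x; have /eX[y ->] := hh x; exists y.
exists f', f'', g', g'', h'; split=> // x.
by rewrite !(linear_funB _ _ (lX _)) g''E f''E h'E ddX (linear_fun0 lh) subr0 subrr.
Qed.

(** If u is a cocycle on X, then u g' is one on Y, hence w d for some w, and u
    differs from u g' f' = w f d by the homotopy term u h d. *)
Lemma hom_exact_resolution M N (X Y : nat -> lmodType S)
    (dX : forall i, X i.+1 -> X i) (aX : X 0%N -> M)
    (dY : forall i, Y i.+1 -> Y i) (aY : Y 0%N -> M) i :
  resolution dX aX -> resolution dY aY -> hom_exact N dY i -> hom_exact N dX i.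
Proof.
move=> rX rY eY u lu u0.
have [f [f' [g [g' [h [[lf lf' lg lg' lh] ff gg hh]]]]]] := comparison rX rY i.
have [[pX lX laX] sX eX0 eX] := rX.
have [[pY lY _] _ _ eYe] := rY.
have [||w lw wE] := eY (fun y => u (g' y)); first exact: linear_comp.
  move=> y; have /eX[x ->] : dX i (g' (dY i.+1 y)) = 0; last exact: u0.
  have -> : dX i (g' (dY i.+1 y)) = g (dY i (dY i.+1 y)) by [].
  by rewrite (proj2 (eYe i _)) ?linear_fun0 //; exists y.
exists (fun x => w (f x) + u (h x)).
  by move=> a x y; rewrite lf lw lh lu scalerDr addrACA.
move=> x; have /eX[z hz] := hh x.
have xE : x = g' (f' x) + h (dX i x) + dX i.+1 z.
  by rewrite -hz -addrA [h _ + _]addrC subrK addrC subrK.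
by rewrite [in LHS]xE linear_funD // u0 addr0 linear_funD // wE ff.
Qed.

Lemma fglift_linear M N (f : M -> N) : linear (fglift f : {freeg M / S} -> N).
Proof.
pose g : {freeg M / S} -> N := fglift f.
pose gA := GRing.isZmodMorphism.Build _ _ g (lift_is_additive f).
pose ga : {additive {freeg M / S} -> N} := HB.pack g gA.
have gD x y : g (x + y) = g x + g y by rewrite -[g]/(ga : _ -> _) raddfD.
have g_sum (r : seq M) F : g (\sum_(x <- r) F x) = \sum_(x <- r) g (F x).
  by rewrite -[g]/(ga : _ -> _) raddf_sum.
move=> c x y; rewrite -[LHS]/(g (c *: x + y)) gD; congr (_ + _).
rewrite -[RHS]/(c *: g x) -{2}[x]freeg_sumE -[c *: x]/(fgscale c x) /fgscale.
rewrite !g_sum scaler_sumr.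
by apply: eq_bigr => z _; rewrite /g !liftU scalerA.
Qed.

Lemma freeg_lifting M : lifting {freeg M / S}.
Proof.
move=> X Y p g lp lg pg.
have [c hc] := choice (fun z : M => pg << z >>).
exists (fglift c); first exact: fglift_linear.
move=> x; rewrite -[x]freeg_sumE.
have big_lin (V : lmodType S) (k : {freeg M / S} -> V) : linear k ->
    forall (r : seq M) F, k (\sum_(z <- r) F z) = \sum_(z <- r) k (F z).
  move=> lk r F; apply: (big_morph k) => [u v|]; last exact: linear_fun0.
  exact: linear_funD.
rewrite (big_lin _ (fun x => p (fglift c x))); last first.
  by apply: linear_comp => //; apply: fglift_linear.
rewrite (big_lin _ g) //; apply: eq_bigr => z _.
have -> : << coeff z x *g z >> = coeff z x *: (<< z >> : {freeg M / S}).
  by rewrite -[RHS]/(fgscale _ _); apply/eqP/freeg_eqP => w;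
      rewrite coeff_fgscale !coeffU mul1r.
by rewrite !linear_funZ //; [rewrite liftU scale1r hc|apply: fglift_linear].
Qed.

Lemma canonical_resolution M :
  resolution (@res_d S M) (@aug S (syz M 0) : res M 0 -> M).
Proof.
split=> [|m|x|i x]; last exact: res_exact.
- split=> [i|i|]; first exact: freeg_lifting; last exact: aug_is_linear.
  move=> c x y; rewrite /res_d aug_is_linear.
  exact: (linearP (\val : syz_type (syz M i) -> {freeg (syz M i) / S})).
- by exists << m >>; rewrite /aug liftU scale1r.
split=> [ax|[y ->]]; last by rewrite /res_d; case: (aug y) => z /= /eqP ->.
have xk : x \in @aug_ker S (syz M 0) by apply/eqP.
by exists << Syz xk >>; rewrite /res_d /aug liftU scale1r.
Qed.

Lemma ExtE M N i :
  (exists x : Ext M N i.+1, x != 0) <-> ~ hom_exact N (@res_d S M) i.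
Proof.
have cob (u : cocycle_type M N i.+1) :
    (\pi_(Ext M N i.+1) u == 0)%qT = `[< coboundary (cocycle_val u) >].
  rewrite -(raddf0 (\pi_(Ext M N i.+1))%qT) -Quotient.idealrBE subr0.
  by [].
split=> [[x x0] ex|nex].
  move: x0; rewrite -[x]reprK cob; case: (repr x) => u uc /=.
  case/negP; apply/asboolP; have /asboolP[lu u0] := uc.
  have [w lw uw] := ex u lu u0; exists w; split=> //.
  by apply/funext => z; apply: uw.
apply: contrapT => nx; apply: nex => u lu u0.
have uc : u \in @cocycle S M N i.+1 by apply/asboolP.
have : (\pi_(Ext M N i.+1) (Cocycle uc) == 0)%qT.
  by apply: contrapT => /negP h; apply: nx; exists (\pi_(Ext M N i.+1) (Cocycle uc))%qT.
by rewrite cob => /asboolP[w [lw /= ->]]; exists w.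
Qed.

End Resolutions.

(** * Resolutions by matrices *)

Section MatrixResolutions.
Variable Q : comNzRingType.
Implicit Types (A : Q -> Prop) (M N : lmodType Q).

Definition mx_in A m n (B : 'M[Q]_(m, n)) := forall i j, A (B i j).

Definition mx_act N m n (B : 'M[Q]_(m, n)) (u : 'I_n -> N) : 'I_m -> N :=
  fun i => \sum_j B i j *: u j.

(** A free resolution of M over Q/A, written with matrices over Q that are
    composed and compared modulo A.  In this form one family of matrices can be
    used over several quotients of Q. *)
Definition mx_resolution A M (r : nat -> nat) (D : forall i, 'M[Q]_(r i.+1, r i))
    (e : 'rV[Q]_(r 0%N) -> M) :=
  [/\ linear e /\ forall m, exists a, e a = m,
      forall a, e a = 0 <-> exists b, mx_in A (a - b *m D 0%N),
      forall i, mx_in A (D i.+1 *m D i)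
    & forall i (a : 'rV_(r i.+1)), mx_in A (a *m D i) ->
        exists b, mx_in A (a - b *m D i.+1)].

Definition mx_exact N (r : nat -> nat) (D : forall i, 'M[Q]_(r i.+1, r i)) i :=
  forall u : 'I_(r i.+1) -> N, mx_act (D i.+1) u = 0 ->
  exists w, u = mx_act (D i) w.

Lemma mx_act_linear N m n (B : 'M[Q]_(m, n)) : linear (@mx_act N m n B).
Proof.
move=> q u v; apply/funext => i; rewrite /mx_act !fctE scaler_sumr -big_split.
by apply: eq_bigr => j _; rewrite scalerDr !scalerA mulrC.
Qed.

Lemma mx_actM N m n p (B : 'M[Q]_(m, n)) (C : 'M[Q]_(n, p)) (u : 'I_p -> N) :
  mx_act (B *m C) u = mx_act B (mx_act C u).
Proof.
apply/funext => i; rewrite /mx_act.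
under eq_bigr do rewrite mxE scaler_suml.
rewrite exchange_big; apply: eq_bigr => j _ /=.
by rewrite scaler_sumr; apply: eq_bigr => k _; rewrite scalerA.
Qed.

Lemma mx_actD N m n (B C : 'M[Q]_(m, n)) (u : 'I_n -> N) :
  mx_act (B + C) u = mx_act B u + mx_act C u.
Proof.
apply/funext => i; rewrite fctE /mx_act -big_split; apply: eq_bigr => j _.
by rewrite mxE scalerDl.
Qed.

Lemma mx_actZ N m n q (B : 'M[Q]_(m, n)) (u : 'I_n -> N) :
  mx_act (q *: B) u = q *: mx_act B u.
Proof.
apply/funext => i; rewrite fctE /mx_act scaler_sumr; apply: eq_bigr => j _.
by rewrite mxE scalerA.
Qed.

Lemma mx_actN N m n (B : 'M[Q]_(m, n)) (u : 'I_n -> N) :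
  mx_act (- B) u = - mx_act B u.
Proof. by rewrite -scaleN1r mx_actZ scaleN1r. Qed.

Lemma mx_act_in N A m n (B : 'M[Q]_(m, n)) (u : 'I_n -> N) :
  (forall a x, A a -> a *: (x : N) = 0) -> mx_in A B -> mx_act B u = 0.
Proof. by move=> AN BA; apply/funext => i; apply: big1 => j _; apply/AN/BA. Qed.

Section MxIn.
Variables (A : Q -> Prop) (hA : @submodule Q Q^o A).

Lemma mx_in0 m n : mx_in A (0 : 'M_(m, n)).
Proof. by move=> i j; rewrite mxE; case: hA. Qed.

Lemma mx_inD m n (B C : 'M_(m, n)) : mx_in A B -> mx_in A C -> mx_in A (B + C).
Proof. by move=> hB hC i j; rewrite mxE; apply: (idealD hA). Qed.

Lemma mx_inZ m n q (B : 'M_(m, n)) : mx_in A B -> mx_in A (q *: B).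
Proof. by move=> hB i j; rewrite mxE; apply: (idealM _ hA). Qed.

Lemma mx_inN m n (B : 'M_(m, n)) : mx_in A B -> mx_in A (- B).
Proof. by move=> hB; rewrite -scaleN1r; apply: mx_inZ. Qed.

Lemma mx_inB m n (B C : 'M_(m, n)) : mx_in A B -> mx_in A C -> mx_in A (B - C).
Proof. by move=> hB hC; apply: mx_inD => //; apply: mx_inN. Qed.

Lemma mx_inMl m n p (B : 'M_(m, n)) (C : 'M_(n, p)) : mx_in A C -> mx_in A (B *m C).
Proof.
move=> hC i j; rewrite mxE; elim/big_ind: _ => [|x y|k _]; first by case: hA.
  exact: (idealD hA).
exact: (idealM _ hA).
Qed.

Lemma mx_inMr m n p (B : 'M_(m, n)) (C : 'M_(n, p)) : mx_in A B -> mx_in A (B *m C).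
Proof.
move=> hB i j; rewrite mxE; elim/big_ind: _ => [|x y|k _]; first by case: hA.
  exact: (idealD hA).
by rewrite mulrC; apply: (idealM _ hA).
Qed.

End MxIn.

Definition rows_mx n (l : seq 'rV[Q]_n) : 'M[Q]_(size l, n) := \matrix_i l`_i.

Lemma span_rows n (l : seq 'rV[Q]_n) a : in_span l a -> exists b, a = b *m rows_mx l.
Proof.
move=> [b ->]; exists (\row_i b i); rewrite mulmx_sum_row.
by apply: eq_bigr => i _; rewrite mxE rowK.
Qed.

Section Existence.
Hypothesis noethQ : noetherian_mod Q^o.
Variables (A : Q -> Prop) (hA : @submodule Q Q^o A).

Lemma mx_kernel p q (B : 'M[Q]_(p, q)) : exists r (C : 'M[Q]_(r, p)),
  mx_in A (C *m B) /\ forall a : 'rV_p, mx_in A (a *m B) -> exists b, a = b *m C.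
Proof.
have hP : submodule (fun a : 'rV[Q]_p => mx_in A (a *m B)).
  split=> [|c x y hx hy]; first by rewrite mul0mx; apply: mx_in0.
  by rewrite mulmxDl -scalemxAl; apply: mx_inD => //; apply: mx_inZ.
have [l [lP Pl]] := noetherian_row noethQ hP.
exists (size l), (rows_mx l); split=> [i j|a /Pl/span_rows //].
have := lP l`_i (mem_nth _ (ltn_ord i)) 0 j.
by rewrite !mxE; under eq_bigr do rewrite -[l`_i](rowK (fun i => l`_i)) mxE.
Qed.

Lemma mx_resolution_exists M : fin_gen M -> (forall a x, A a -> a *: (x : M) = 0) ->
  exists r D e, @mx_resolution A M r D e.
Proof.
move=> [s hs] AM.
pose e (a : 'rV[Q]_(size s)) := \sum_i a 0 i *: s`_i.
have le : linear e.
  move=> q x y; rewrite /e scaler_sumr -big_split; apply: eq_bigr => i _ /=.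
  by rewrite !mxE scalerDl scalerA.
have hP : submodule (fun a => e a = 0).
  split=> [|q x y ex ey]; first exact: linear_fun0.
  by rewrite le ex ey scaler0 addr0.
have [l [lP Pl]] := noetherian_row noethQ hP.
pose st := {q : nat & {p : nat & 'M[Q]_(p, q)}}.
pose D0 : st := existT _ (size s) (existT _ (size l) (rows_mx l)).
have ex (x : st) : exists y : {r : nat & 'M[Q]_(r, projT1 (projT2 x))},
    mx_in A (projT2 y *m projT2 (projT2 x)) /\
    forall a : 'rV_(projT1 (projT2 x)), mx_in A (a *m projT2 (projT2 x)) ->
      exists b, a = b *m projT2 y.
  by have [r [C hC]] := mx_kernel (projT2 (projT2 x)); exists (existT _ r C).
pose nx x := projT1 (cid (ex x)); have hnx x := projT2 (cid (ex x)).
pose next (x : st) : st := existT _ (projT1 (projT2 x)) (nx x).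
pose c i := iter i next D0.
exists (fun i => projT1 (c i)), (fun i => projT2 (projT2 (c i))), e.
split=> [|a|i|i a].
- by split=> // m; have [a ->] := hs m; exists (\row_i a i);
    apply: eq_bigr => i _; rewrite mxE.
- split=> [/Pl/span_rows[b ->]|[b hb]].
    by exists b; rewrite subrr; apply: mx_in0.
  rewrite -[a](subrK (b *m rows_mx l)) linear_funD //.
  rewrite {1}/e big1 => [|i _]; last exact/AM/hb.
  rewrite add0r mulmx_sum_row linear_fun_sum // big1 // => i _.
  by rewrite linear_funZ // rowK lP ?scaler0 // mem_nth.
- by case: (hnx (c i)).
by move=> ha; have [_ /(_ a ha)[b ->]] := hnx (c i); exists b; rewrite subrr; apply: mx_in0.
Qed.

End Existence.

Section ExtMatrix.
Variables (S : nzRingType) (phi : {rmorphism Q -> S}) (A : Q -> Prop).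
Hypotheses (phi_surj : forall x, exists q, phi q = x)
           (phi_ker : forall q, phi q = 0 <-> A q).

(** Modules over different quotients of Q with the same underlying Q-module
    are compared through such maps f, from M0 to M restricted along phi. *)
Definition restriction_iso (M0 : lmodType Q) (M : lmodType S) (f : M0 -> M) :=
  [/\ bijective f, {morph f : x y / x + y} & forall q x, f (q *: x) = phi q *: f x].

Variables (M0 N0 : lmodType Q) (M N : lmodType S) (f : M0 -> M) (g : N0 -> N).
Hypotheses (hf : restriction_iso f) (hg : restriction_iso g).
Variables (r : nat -> nat) (D : forall i, 'M[Q]_(r i.+1, r i)).
Variables (e : 'rV[Q]_(r 0%N) -> M0).
Hypothesis hD : mx_resolution A D e.

Let X i : lmodType S := 'rV[S]_(r i).
Let d i (x : X i.+1) : X i := x *m map_mx phi (D i).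
Let a (x : X 0%N) : M := \sum_j x 0 j *: f (e (delta_mx 0 j)).

Lemma row_lifting n : lifting ('rV[S]_n : lmodType S).
Proof.
move=> Y Z p h lp lh ph.
have [c hc] := choice (fun j : 'I_n => ph (delta_mx 0 j)).
exists (fun x : 'rV[S]_n => \sum_j x 0 j *: c j).
  move=> q x y; rewrite scaler_sumr -big_split; apply: eq_bigr => j _ /=.
  by rewrite !mxE scalerDl scalerA.
move=> x; rewrite {2}[x]row_sum_delta !linear_fun_sum //; apply: eq_bigr => j _.
by rewrite !linear_funZ // hc.
Qed.

Lemma map_mx_surj m n (x : 'M[S]_(m, n)) : exists y : 'M[Q]_(m, n), map_mx phi y = x.
Proof.
have [c hc] := choice phi_surj.
by exists (map_mx c x); apply/matrixP => i j; rewrite !mxE hc.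
Qed.

Lemma map_mx_ker m n (y : 'M[Q]_(m, n)) : map_mx phi y = 0 <-> mx_in A y.
Proof.
split=> [y0 i j|hy].
  by apply/phi_ker; have := congr1 (fun z : 'M_(m, n) => z i j) y0; rewrite !mxE.
by apply/matrixP => i j; rewrite !mxE; apply/phi_ker.
Qed.

Lemma aug_map y : a (map_mx phi y) = f (e y).
Proof.
case: hf => _ fD fZ; case: hD => [[le _] _ _ _].
have f0 : f 0 = 0 by have := fZ 0 0; rewrite scaler0 rmorph0 scale0r.
rewrite {2}[y]row_sum_delta linear_fun_sum // (big_morph f fD f0).
by apply: eq_bigr => j _; rewrite mxE linear_funZ // fZ.
Qed.

Lemma row_resolution : resolution d a.
Proof.
case: (hf) => -[f' fK f'K] fD fZ; case: hD => [[le se] e0 DD eD].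
have f0 : f 0 = 0 by have := fZ 0 0; rewrite scaler0 rmorph0 scale0r.
split=> [|m|x|i x].
- split=> [i|i|]; first exact: row_lifting.
    by move=> q x y; rewrite /d mulmxDl scalemxAl.
  move=> q x y; rewrite scaler_sumr -big_split; apply: eq_bigr => j _ /=.
  by rewrite !mxE scalerDl scalerA.
- by have [y hy] := se (f' m); exists (map_mx phi y); rewrite aug_map hy f'K.
- have [y <-] := map_mx_surj x; rewrite aug_map; split=> [ey|[z hz]].
    have /e0[b hb] : e y = 0 by rewrite -[e y]fK ey -f0 fK.
    exists (map_mx phi b); apply/subr0_eq; rewrite /d -map_mxM -raddfB.
    exact/map_mx_ker.
  have [b hb] := map_mx_surj z.
  rewrite (proj2 (e0 y)) ?f0 //; exists b; apply/map_mx_ker.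
  by rewrite raddfB /= map_mxM hz hb /d subrr.
have [y <-] := map_mx_surj x; rewrite /d -map_mxM; split=> [/map_mx_ker/eD[b hb]|[z hz]].
  exists (map_mx phi b); apply/subr0_eq; rewrite -map_mxM -raddfB.
  exact/map_mx_ker.
have [b hb] := map_mx_surj z.
rewrite map_mxM hz -hb -mulmxA -map_mxM.
by rewrite (proj2 (map_mx_ker (_ *m _)) (DD i)) mulmx0.
Qed.

Lemma hom_mx_exact i : hom_exact N d i <-> mx_exact N0 D i.
Proof.
case: (hg) => -[g' gK g'K] gD gZ.
have g0 : g 0 = 0 by have := gZ 0 0; rewrite scaler0 rmorph0 scale0r.
pose hom n (v : 'I_n -> N0) (x : 'rV[S]_n) : N := \sum_j x 0 j *: g (v j).
have hom_lin n v : linear (@hom n v).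
  move=> q x y; rewrite scaler_sumr -big_split; apply: eq_bigr => j _ /=.
  by rewrite !mxE scalerDl scalerA.
have homM m n (B : 'M[Q]_(m, n)) v x : hom _ v (x *m map_mx phi B) = hom _ (mx_act B v) x.
  rewrite /hom; under eq_bigr do rewrite mxE scaler_suml.
  rewrite exchange_big; apply: eq_bigr => j _; rewrite /mx_act /=.
  rewrite (big_morph g gD g0) scaler_sumr; apply: eq_bigr => k _.
  by rewrite gZ scalerA mxE.
have homE n (u : 'rV[S]_n -> N) : linear u ->
    exists v, forall x, u x = hom n v x.
  move=> lu; exists (fun j => g' (u (delta_mx 0 j))) => x.
  rewrite {1}[x]row_sum_delta linear_fun_sum //; apply: eq_bigr => j _.
  by rewrite linear_funZ // g'K.
have hom_inj n v w : (forall x, hom n v x = hom n w x) -> v = w.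
  move=> vw; apply/funext => j; apply: (can_inj gK).
  have homd u : hom n u (delta_mx 0 j) = g (u j).
    rewrite /hom (bigD1 j) //= mxE !eqxx scale1r big1 ?addr0 // => k kj.
    by rewrite mxE (negbTE kj) andbF scale0r.
  by rewrite -!homd.
have hom0 n x : hom n 0 x = 0.
  by apply: big1 => j _; rewrite -[X in g X]/(0 : N0) g0 scaler0.
split=> [ex v v0|ex u lu u0].
  have [||w lw wE] := ex (hom _ v); first exact: hom_lin.
    by move=> x; rewrite /d homM v0 hom0.
  have [w' hw'] := homE _ w lw; exists w'; apply: hom_inj => x.
  by rewrite wE hw' homM.
have [v hv] := homE _ u lu.
have [|w wE] := ex v.
  by apply: hom_inj => x; rewrite -homM -hv u0 hom0.
exists (hom _ w); first exact: hom_lin.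
by move=> x; rewrite hv wE homM.
Qed.

Lemma Ext_mx i : (exists x : Ext M N i.+1, x != 0) <-> ~ mx_exact N0 D i.
Proof.
rewrite ExtE; apply: not_iff_compat; rewrite -hom_mx_exact.
have rX := row_resolution; have rC := canonical_resolution M.
by split; apply: (hom_exact_resolution (N := N)); eassumption.
Qed.

End ExtMatrix.
End MatrixResolutions.

(** * Passing from Q/(A, h) to Q/A *)

Section Cone.
Variable Q : comNzRingType.
Implicit Types (A : Q -> Prop) (M N : lmodType Q).

(** Degrees are shifted by one, with zero in front, so that the first map of
    the cone below is not a special case. *)
Definition shift_rank (r : nat -> nat) i := if i is j.+1 then r j else 0%N.

Definition shift_mx r (D : forall i, 'M[Q]_(r i.+1, r i)) i :
    'M[Q]_(shift_rank r i.+1, shift_rank r i) :=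
  if i is j.+1 then D j else 0.

Definition cone_rank (r : nat -> nat) i := (shift_rank r i.+1 + shift_rank r i)%N.

Definition cone_mx r (D : forall i, 'M[Q]_(r i.+1, r i)) h
    (t : forall i, 'M[Q]_(shift_rank r i.+2, shift_rank r i)) i :
    'M[Q]_(cone_rank r i.+1, cone_rank r i) :=
  block_mx (shift_mx D i.+1) (- t i) h%:M (- shift_mx D i).

Definition cone_aug M (r : nat -> nat) (e : 'rV[Q]_(r 0%N) -> M)
    (a : 'rV[Q]_(cone_rank r 0)) : M :=
  e (lsubmx (a : 'rV[Q]_(shift_rank r 1 + shift_rank r 0))).

Lemma mx_in_add_gen A h m n (B : 'M_(m, n)) :
  mx_in (add_gen A h) B <-> exists w, mx_in A (B - h *: w).
Proof.
split=> [hB|[w hw] i j]; last by exists (w i j); have := hw i j; rewrite !mxE mulrC.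
pose w := \matrix_(i, j) projT1 (cid (hB i j)); exists w => i j.
by rewrite !mxE mulrC; case: cid.
Qed.

Lemma mx_in_row A m n p (B : 'M_(m, n)) (C : 'M_(m, p)) :
  mx_in A (row_mx B C) <-> mx_in A B /\ mx_in A C.
Proof.
split=> [h|[hB hC] i j]; last by rewrite mxE; case: fintype.split.
by split=> i j; [have := h i (lshift p j)|have := h i (rshift n j)];
  rewrite ?row_mxEl ?row_mxEr.
Qed.

Lemma mx_in_block A m n p q (B : 'M_(m, n)) (C : 'M_(m, p)) (D : 'M_(q, n)) (E : 'M_(q, p)) :
  mx_in A B -> mx_in A C -> mx_in A D -> mx_in A E -> mx_in A (block_mx B C D E).
Proof.
move=> hB hC hD hE i j; rewrite mxE.
by case: fintype.split => k; rewrite mxE; case: fintype.split.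
Qed.

Lemma mx_in_zero m n (B : 'M[Q]_(m, n)) : mx_in (fun y => y = 0) B -> B = 0.
Proof. by move=> hB; apply/matrixP => i j; rewrite hB mxE. Qed.

Section ConeResolution.
Variables (A : Q -> Prop) (h : Q) (M : lmodType Q) (r : nat -> nat).
Variables (D : forall i, 'M[Q]_(r i.+1, r i)) (e : 'rV[Q]_(r 0%N) -> M).
Variable (t : forall i, 'M[Q]_(shift_rank r i.+2, shift_rank r i)).
Hypotheses (hA : @submodule Q Q^o A) (nzh : nonzerodivisor A h).
Hypothesis hD : mx_resolution (add_gen A h) D e.
Local Notation DD := (shift_mx D).
Hypothesis ht : forall i, mx_in A (DD i.+1 *m DD i - h *: t i).

Lemma mx_in_cancel m n (B : 'M_(m, n)) : mx_in A (h *: B) -> mx_in A B.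
Proof. by move=> hB i j; apply: nzh; have := hB i j; rewrite mxE. Qed.

(** h (D t - t D) = D (D D) - (D D) D modulo A, and h may be cancelled. *)
Lemma operator_commutes i : mx_in A (DD i.+2 *m t i - t i.+1 *m DD i).
Proof.
apply: mx_in_cancel.
have -> : h *: (DD i.+2 *m t i - t i.+1 *m DD i) =
   (DD i.+2 *m DD i.+1 - h *: t i.+1) *m DD i
   - DD i.+2 *m (DD i.+1 *m DD i - h *: t i).
  rewrite scalerBr mulmxBl mulmxBr -!scalemxAl -!scalemxAr mulmxA.
  by rewrite opprB [RHS]addrC addrA subrK.
by apply: mx_inB => //; [apply: mx_inMr|apply: mx_inMl].
Qed.

(** Exactness of the cone: reduce (a, b) modulo h to an element that the given
    resolution can correct; what is left has its first entry in A, and then h b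
    lies in A, hence b does. *)
Lemma cone_resolution : mx_resolution A (cone_mx D h t) (cone_aug e).
Proof.
case: (hD) => [[le se] e0 DD0 eD].
split=> [|a|i|i a].
- split=> [q x y|m]; first by rewrite /cone_aug linearP le.
  by have [a ha] := se m; exists (row_mx a 0); rewrite /cone_aug row_mxKl.
- rewrite /cone_aug; move: a; rewrite /cone_rank /= => a.
  rewrite -[a]hsubmxK; move: (lsubmx a) (rsubmx a) => {}a b; rewrite row_mxKl.
  rewrite e0; split=> [[c /mx_in_add_gen[w hw]]|[c]].
    exists (row_mx c w); rewrite mul_row_block opp_row_mx add_row_mx.
    apply/mx_in_row; split; last by rewrite [_ + _]thinmx0; apply: mx_in0.
    by rewrite mul_mx_scalar opprD addrA.
  rewrite -[c]hsubmxK mul_row_block opp_row_mx add_row_mx => /mx_in_row[hc _].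
  exists (lsubmx c); apply/mx_in_add_gen; exists (rsubmx c).
  by move: hc; rewrite mul_mx_scalar opprD addrA.
- rewrite /cone_mx mulmx_block; apply: mx_in_block.
  + by rewrite mul_mx_scalar scalerN; apply: ht.
  + by rewrite mulmxN mulNmx mulmxN opprK addrC -opprB;
      apply: mx_inN => //; apply: operator_commutes.
  + by rewrite mul_mx_scalar mul_scalar_mx scalerN subrr; apply: mx_in0.
  by rewrite mul_scalar_mx mulNmx mulmxN opprK scalerN addrC; apply: ht.
rewrite /cone_mx; move: a; rewrite /cone_rank => a.
rewrite -[a]hsubmxK; move: (lsubmx a) (rsubmx a) => {}a b.
rewrite mul_row_block => /mx_in_row[]; rewrite mul_mx_scalar => h1 _.
have [c [w hu]] : exists (c : 'rV_(shift_rank r i.+3)) (w : 'rV_(shift_rank r i.+2)),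
    mx_in A (a - (c *m DD i.+2 + h *: w)).
  have [|c /mx_in_add_gen[w hw]] := eD i a; last by exists c, w; rewrite opprD addrA.
  by apply/mx_in_add_gen; exists (- b); rewrite scalerN opprK.
exists (row_mx c w); rewrite mul_row_block opp_row_mx add_row_mx mul_mx_scalar.
apply/mx_in_row; split=> //; apply: mx_in_cancel.
have -> : h *: (b - (c *m - t i.+1 + w *m - DD i.+1)) =
    (a *m DD i.+1 + h *: b) - (a - (c *m DD i.+2 + h *: w)) *m DD i.+1
    - c *m (DD i.+2 *m DD i.+1 - h *: t i.+1).
  rewrite !(mulmxN, mulNmx, mulmxBl, mulmxDl, mulmxBr, scalerBr, scalerDr, scalerN).
  rewrite -!scalemxAl -!scalemxAr mulmxA /=.
  move: (a *m _) (h *: b) (h *: (w *m _)) (h *: (c *m _)) (c *m _ *m _).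
  by move=> p q s u v; apply/rowP => j; rewrite !mxE; ring.
apply: mx_inB; [exact: hA| |apply: mx_inMl; [exact: hA|exact: ht]].
apply: mx_inB; [exact: hA|exact: h1|apply: mx_inMr; [exact: hA|exact: hu]].
Qed.

End ConeResolution.

(** * Cohomology of the cone *)

Section Operators.
Variables (N : lmodType Q) (r : nat -> nat) (D : forall i, 'M[Q]_(r i.+1, r i)).
Local Notation rr := (shift_rank r).
Local Notation DD := (shift_mx D).
Local Notation operator := (forall i, 'M[Q]_(rr i.+2, rr i)).
Implicit Types s t : operator.

(** t maps onto the cohomology of Hom(-, N) in (shifted) degree i + 2. *)
Definition onto_cohomology t i :=
  forall z : 'I_(rr i.+2) -> N, mx_act (DD i.+2) z = 0 ->
  exists v w, mx_act (DD i) v = 0 /\ z = mx_act (t i) v + mx_act (DD i.+1) w.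

(** t is injective on the cohomology of Hom(-, N) in (shifted) degree i + 1. *)
Definition into_cohomology t i :=
  forall v : 'I_(rr i.+1) -> N, mx_act (DD i.+1) v = 0 ->
  (exists w, mx_act (t i.+1) v = mx_act (DD i.+2) w) ->
  exists w, v = mx_act (DD i) w.

Definition commutes t := forall i (u : 'I_(rr i) -> N),
  mx_act (DD i.+2) (mx_act (t i) u) = mx_act (t i.+1) (mx_act (DD i) u).

Definition fun_pair m n (u : 'I_m -> N) (v : 'I_n -> N) (i : 'I_(m + n)) : N :=
  match fintype.split i with inl j => u j | inr j => v j end.

Lemma fun_pairK m n (u : 'I_(m + n) -> N) :
  u = fun_pair (fun j => u (lshift n j)) (fun j => u (rshift m j)).
Proof.
apply/funext => i; rewrite /fun_pair -{1}(splitK i).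
by case: (fintype.split i).
Qed.

Lemma fun_pair_inj m n (u u' : 'I_m -> N) (v v' : 'I_n -> N) :
  fun_pair u v = fun_pair u' v' -> u = u' /\ v = v'.
Proof.
move=> uv; split; apply/funext => j.
  have := congr1 (fun w => w (lshift n j)) uv.
  by rewrite /fun_pair (unsplitK (inl _ j)).
have := congr1 (fun w => w (rshift m j)) uv.
by rewrite /fun_pair (unsplitK (inr _ j)).
Qed.

Lemma mx_act_block m n p q (B : 'M[Q]_(m, n)) (C : 'M_(m, p)) (E : 'M_(q, n))
    (F : 'M_(q, p)) (u : 'I_n -> N) v :
  mx_act (block_mx B C E F) (fun_pair u v) =
  fun_pair (mx_act B u + mx_act C v) (mx_act E u + mx_act F v).
Proof.
rewrite [LHS]fun_pairK; congr fun_pair; apply/funext => j;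
  rewrite /mx_act fctE big_split_ord /=; congr (_ + _); apply: eq_bigr => k _;
  rewrite /fun_pair ?(unsplitK (inl _ k)) ?(unsplitK (inr _ k)).
- by rewrite block_mxEul.
- by rewrite block_mxEur.
- by rewrite block_mxEdl.
by rewrite block_mxEdr.
Qed.

Lemma mx_act0 m n (B : 'M[Q]_(m, n)) : mx_act B (0 : 'I_n -> N) = 0.
Proof. exact: (linear_fun0 (@mx_act_linear _ _ _ _ B)). Qed.

Lemma mx_actZr m n (B : 'M[Q]_(m, n)) q (u : 'I_n -> N) :
  mx_act B (q *: u) = q *: mx_act B u.
Proof. exact: (linear_funZ _ _ (@mx_act_linear _ _ _ _ B)). Qed.

Lemma mx_actBr m n (B : 'M[Q]_(m, n)) (u v : 'I_n -> N) :
  mx_act B (u - v) = mx_act B u - mx_act B v.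
Proof. exact: (linear_funB _ _ (@mx_act_linear _ _ _ _ B)). Qed.

(** The long exact sequence of the cone, reduced to what is needed: since h
    kills N, the cone of Hom is the cone of multiplication by t. *)
Lemma cone_exact t h i : (forall x : N, h *: x = 0) -> commutes t ->
  mx_exact N (cone_mx D h t) i <-> onto_cohomology t i /\ into_cohomology t i.
Proof.
move=> hN ct.
have act_h m (u : 'I_m -> N) : mx_act h%:M u = 0.
  apply/funext => j; apply: big1 => k _; rewrite mxE.
  by case: (j == k); rewrite ?mulr1n ?mulr0n ?scale0r // hN.
have coneE k (u : 'I_(rr k.+1) -> N) (v : 'I_(rr k) -> N) :
    mx_act (cone_mx D h t k) (fun_pair u v) =
    fun_pair (mx_act (DD k.+1) u - mx_act (t k) v) (- mx_act (DD k) v).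
  by rewrite /cone_mx mx_act_block act_h add0r !mx_actN.
have pair0 m n : fun_pair (0 : 'I_m -> N) (0 : 'I_n -> N) = 0.
  by apply/funext => j; rewrite /fun_pair; case: fintype.split.
split=> [ex|[onto into]].
  split=> [z z0|v v0 [w hw]].
    have [|u hu] := ex (fun_pair z 0); first by rewrite coneE z0 !mx_act0 subr0 oppr0 pair0.
    move: hu; rewrite [u]fun_pairK coneE => /fun_pair_inj[-> /esym/eqP].
    move: (fun j => u (lshift _ j)) (fun j => u (rshift _ j)) => {}u v.
    rewrite oppr_eq0 => /eqP v0; exists (- v), u.
    by rewrite -[- v]sub0r !mx_actBr v0 !mx_act0 subr0 sub0r addrC.
  have [|u hu] := ex (fun_pair w v).
    by rewrite coneE hw v0 subrr oppr0 pair0.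
  move: hu; rewrite [u]fun_pairK coneE => /fun_pair_inj[_ ->].
  by eexists; rewrite -[- _]sub0r -(mx_act0 (DD i)) -mx_actBr.
move=> u; rewrite [u]fun_pairK.
move: (fun j => u (lshift _ j)) (fun j => u (rshift _ j)) => {}u v.
rewrite coneE -pair0 => /fun_pair_inj[/subr0_eq uv /eqP].
rewrite oppr_eq0 => /eqP v0.
have [|w vw] := into v v0; first by exists u.
have [|v' [w' [v'0 hw']]] := onto (u - mx_act (t i) w).
  by rewrite mx_actBr uv vw ct subrr.
exists (fun_pair w' (- v' - w)); rewrite coneE; congr fun_pair.
  rewrite mx_actBr -[- v']sub0r mx_actBr mx_act0 sub0r opprD !opprK.
  by rewrite addrA [mx_act (DD _) _ + _]addrC -hw' subrK.
by rewrite mx_actBr -[- v']sub0r mx_actBr v'0 mx_act0 subr0 sub0r opprK.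
Qed.

Definition perturb t x s : operator := fun i => t i - x *: s i.

Lemma perturb_act t x s i (v : 'I_(rr i) -> N) :
  mx_act (perturb t x s i) v = mx_act (t i) v - x *: mx_act (s i) v.
Proof. by rewrite /perturb mx_actD mx_actN mx_actZ. Qed.

Section Perturbation.
Variables (t s : operator) (x : Q).
Hypotheses (noethN : noetherian_mod N) (jx : in_jacobson x) (cs : commutes s).

(** Modulo x the two operators agree, so Nakayama applies to the cocycles
    that t - x s does not reach. *)
Lemma perturb_onto i : onto_cohomology t i -> onto_cohomology (perturb t x s) i.
Proof.
move=> onto z.
pose B (z : 'I_(rr i.+2) -> N) := exists v w, mx_act (DD i) v = 0 /\
  z = mx_act (perturb t x s i) v + mx_act (DD i.+1) w.
apply: (nakayama (L := fun z => mx_act (DD i.+2) z = 0) (B := B)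
  (noetherian_fun noethN) jx).
  split=> [|q _ _ [v [w [v0 ->]]] [v' [w' [v'0 ->]]]].
    by exists 0, 0; rewrite !mx_act0 addr0.
  exists (q *: v + v'), (q *: w + w').
  by rewrite !mx_act_linear v0 v'0 scaler0 addr0 scalerDr addrACA.
move=> {}z z0; have [v [w [v0 zE]]] := onto z z0.
exists (mx_act (s i) v); split; first by rewrite cs v0 mx_act0.
by exists v, w; split=> //; rewrite perturb_act zE addrAC.
Qed.

(** On cohomology let p be the inverse of t composed with s.  A class v killed
    by t - x s satisfies v = x p(v), and then p^k(v) = x p^(k+1)(v) for all k:
    Nakayama applies to the family of the p^k(v). *)
Lemma perturb_into i : onto_cohomology t i.+1 -> into_cohomology t i ->
  into_cohomology (perturb t x s) i.
Proof.
move=> onto into v v0 [w0 vw0].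
pose cobound k (z : 'I_(rr k.+1) -> N) := exists w, z = mx_act (DD k) w.
have cob k : submodule (@cobound k).
  split=> [|q _ _ [w ->] [w' ->]]; first by exists 0; rewrite mx_act0.
  by exists (q *: w + w'); rewrite mx_act_linear.
pose cocycle := fun y : 'I_(rr i.+1) -> N => mx_act (DD i.+1) y = 0.
have ex y : exists y', cocycle y ->
    cocycle y' /\ cobound i.+2 (mx_act (s i.+1) y - mx_act (t i.+1) y').
  have [y0|ny] := pselect (cocycle y); last by exists 0 => /ny.
  have [|y' [w [y'0 yE]]] := onto (mx_act (s i.+1) y); first by rewrite cs y0 mx_act0.
  by exists y' => _; split=> //; exists w; rewrite yE addrAC subrr add0r.
have [p hp] := choice ex.
pose y k := iter k p v.
have y0 k : cocycle (y k) by elim: k => //= k /hp[].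
have yS k : cobound i.+2 (mx_act (s i.+1) (y k) - mx_act (t i.+1) (y k.+1)).
  by have [] := hp _ (y0 k).
have yx k : cocycle (y k - x *: y k.+1).
  by rewrite /cocycle mx_actBr mx_actZr !y0 scaler0 subrr.
have step k : cobound i (y k - x *: y k.+1).
  elim: k => [|k [w hw]]; apply: (into _ (yx _));
    rewrite -/(cobound i.+2 _) mx_actBr mx_actZr.
    rewrite -[_ - _](subrKA (x *: mx_act (s i.+1) v)) -scalerBr.
    apply: (submodD (cob _)); first by exists w0; rewrite -perturb_act.
    exact: submodZ (cob _) (yS 0%N).
  set a := mx_act _ (y k.+1); set b := mx_act _ (y k.+2).
  have -> : a - x *: b = mx_act (s i.+1) (y k - x *: y k.+1)
      - (mx_act (s i.+1) (y k) - a) + x *: (mx_act (s i.+1) (y k.+1) - b).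
    rewrite mx_actBr mx_actZr scalerBr.
    move: (mx_act (s i.+1) (y k)) (x *: mx_act _ _) (x *: b) => c d e'.
    by rewrite opprB [c - d + _]addrC !subrKA.
  apply: (submodD (cob _)); last exact: submodZ (cob _) (yS _).
  apply: (submodB (cob _)); last exact: yS.
  by rewrite hw -cs; exists (mx_act (s i) w).
apply: (nakayama (L := fun z => exists k, z = y k) (B := @cobound i)
  (noetherian_fun noethN) jx (cob i)); last by exists 0%N.
by move=> _ [k ->]; exists (y k.+1); split; [exists k.+1|apply: step].
Qed.

End Perturbation.
End Operators.
(** * Changing the hypersurface *)

Local Notation principal f := (add_gen (fun y : Q => y = 0) f).

Lemma add_gen_shift A f h x : @submodule Q Q^o A ->
  add_gen (add_gen A (f + x * h)) h = add_gen (add_gen A f) h.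
Proof.
move=> hA; apply/funext => y; apply/propext; split=> -[b [a hab]].
  exists (b + a * x), a; move: hab; congr A; ring.
exists (b - a * x), a; move: hab; congr A; ring.
Qed.

(** The step from f to f + x h.  In D D = f s + h t one has f = 0 over Q/(f)
    and f = - x h over Q/(f + x h); the two cones are thus built from the same
    resolution over Q/(f, h), with t and with t - x s. *)
Lemma hypersurface_step M N f h x :
  noetherian_mod Q^o -> fin_gen M -> fin_gen N ->
  (forall m : M, f *: m = 0) -> (forall m : M, h *: m = 0) ->
  (forall m : N, f *: m = 0) -> (forall m : N, h *: m = 0) ->
  in_jacobson x -> nonzerodivisor (fun y => y = 0) f ->
  nonzerodivisor (principal f) h -> nonzerodivisor (principal (f + x * h)) h ->
  exists r D e r' D' e',
    [/\ @mx_resolution Q (principal f) M r D e,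
        @mx_resolution Q (principal (f + x * h)) M r' D' e'
      & forall k, (forall i, (k <= i)%N -> mx_exact N D i) ->
                  (forall i, (k <= i)%N -> mx_exact N D' i)].
Proof.
move=> noethQ fgM fgN fM hM fN hN jx nzf nzh nzh'.
have zI := ideal_zero Q.
have fI := add_gen_ideal f zI; have f'I := add_gen_ideal (f + x * h) zI.
have kill (P : lmodType Q) (g : Q) : (forall m : P, g *: m = 0) ->
    forall a (m : P), principal g a -> a *: m = 0.
  by move=> gP a m [q /subr0_eq ->]; rewrite -scalerA gP scaler0.
have [|r [D [e hD]]] := mx_resolution_exists noethQ (add_gen_ideal h fI) fgM.
  move=> a m [b [q /subr0_eq /(canRL (subrK _)) ->]].
  by rewrite scalerDl -!scalerA fM hM !scaler0 addr0.
pose DD := shift_mx D.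
have DDin i : mx_in (add_gen (principal f) h) (DD i.+1 *m DD i).
  case: i => [|i]; last by case: hD => _ _ /(_ i).
  by rewrite /DD /= mulmx0; apply: mx_in0; apply: add_gen_ideal.
have ex i : exists u : 'M[Q]_(_, _) * 'M[Q]_(_, _),
    DD i.+1 *m DD i = f *: u.1 + h *: u.2.
  have /mx_in_add_gen[t /mx_in_add_gen[s hs]] := DDin i.
  exists (s, t); apply/subr0_eq.
  by rewrite -[RHS](mx_in_zero hs) opprD addrA addrAC.
pose s i := (projT1 (cid (ex i))).1; pose t i := (projT1 (cid (ex i))).2.
have stE i : DD i.+1 *m DD i = f *: s i + h *: t i by rewrite /s /t; case: cid.
have ht i : mx_in (principal f) (DD i.+1 *m DD i - h *: t i).
  by rewrite stE addrK => j k; rewrite mxE mulrC; exists (s i j k); rewrite subrr.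
pose t' := perturb t x s.
have ht' i : mx_in (principal (f + x * h)) (DD i.+1 *m DD i - h *: t' i).
  move=> j k; exists (s i j k); rewrite stE /t' /perturb !mxE; ring.
have rD := cone_resolution fI nzh hD ht.
have hD' : mx_resolution (add_gen (principal (f + x * h)) h) D e.
  by rewrite add_gen_shift.
have rD' := cone_resolution f'I nzh' hD' ht'.
have f'N (m : N) : (f + x * h) *: m = 0.
  by rewrite scalerDl -scalerA fN hN scaler0 addr0.
have comm_in A (u : forall i, 'M[Q]_(shift_rank r i.+2, shift_rank r i)) :
    (forall a (m : N), A a -> a *: m = 0) ->
    (forall i, mx_in A (DD i.+2 *m u i - u i.+1 *m DD i)) -> commutes N D u.
  move=> AN hu i v; apply/subr0_eq.
  by rewrite -!mx_actM -mx_actN -mx_actD; apply: mx_act_in (hu i).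
have ct : commutes N D t.
  exact: comm_in (kill N f fN) (operator_commutes fI nzh ht).
have ct' : commutes N D t'.
  exact: comm_in (kill N _ f'N) (operator_commutes f'I nzh' ht').
have cs : commutes N D s.
  apply: (comm_in (principal h)); first exact: kill.
  move=> i; have /mx_in_add_gen[w hw] := operator_commutes fI nzh ht (i := i).
  have wE : DD i.+2 *m t i - t i.+1 *m DD i = f *: w.
    exact/subr0_eq/mx_in_zero.
  apply/mx_in_add_gen; exists (- w); apply: (mx_in_cancel nzf).
  suff -> : f *: (DD i.+2 *m s i - s i.+1 *m DD i - h *: - w) = 0 by apply: mx_in0.
  have : DD i.+2 *m (DD i.+1 *m DD i) - DD i.+2 *m DD i.+1 *m DD i = 0.
    by rewrite mulmxA subrr.
  rewrite !stE mulmxDr mulmxDl -!scalemxAr -!scalemxAl => E.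
  rewrite -[RHS]E scalerN opprK scalerDr scalerA mulrC -scalerA -wE !scalerBr.
  by rewrite opprD addrACA.
have nN := noetherian_fin_gen noethQ fgN.
exists (cone_rank r), (cone_mx D h t), (cone_aug e).
exists (cone_rank r), (cone_mx D h t'), (cone_aug e).
split=> // k ex_k i ki.
have [onto into] := (cone_exact i hN ct).1 (ex_k i ki).
apply/(cone_exact i hN ct'); split; first exact: perturb_onto.
apply: perturb_into => //.
by have [] := (cone_exact i.+1 hN ct).1 (ex_k i.+1 (leqW ki)).
Qed.

End Cone.

(** * Independence of the representative *)

Section Representatives.
Variable Q : comNzRingType.
Local Notation principal f := (add_gen (fun y : Q => y = 0) f).

Definition infinite_ext (K : idealr Q) (M N : lmodType {ideal_quot K})
    (f : ideal_elt K) :=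
  forall m : nat, exists i : nat, (m <= i)%N /\
    exists x : Ext (restr (quot_map (@princ_sub _ _ f)) M)
                   (restr (quot_map (@princ_sub _ _ f)) N) i, x != 0.

Definition over_Q (K : idealr Q) (M : lmodType {ideal_quot K}) : lmodType Q :=
  restr (\pi_({ideal_quot K})%qT : {rmorphism Q -> {ideal_quot K}}) M.

Lemma infinite_ext_mx (K : idealr Q) (M N : lmodType {ideal_quot K})
    (f : ideal_elt K) (M0 N0 : lmodType Q) (iM : M0 -> M) (iN : N0 -> N) r D e :
  restriction_iso (\pi_({ideal_quot K})%qT : {rmorphism Q -> {ideal_quot K}}) iM ->
  restriction_iso (\pi_({ideal_quot K})%qT : {rmorphism Q -> {ideal_quot K}}) iN ->
  @mx_resolution Q (principal (ideal_val f)) M0 r D e ->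
  infinite_ext M N f <-> forall m, exists2 i, (m <= i)%N & ~ mx_exact N0 D i.
Proof.
move=> hM hN hD.
pose S := {ideal_quot (@princ _ _ f)}.
pose phi : {rmorphism Q -> S} := \pi_(S)%qT.
have phi_surj (x : S) : exists q, phi q = x by exists (repr x); exact: reprK.
have phi_ker q : phi q = 0 <-> principal (ideal_val f) q.
  rewrite -(rmorph0 phi); split=> [/eqP|[a /subr0_eq ->]].
    rewrite /phi -Quotient.idealrBE subr0 => /asboolP[a ->].
    by exists a; rewrite subrr.
  by apply/eqP; rewrite /phi -Quotient.idealrBE subr0; apply/asboolP; exists a.
have restr_iso (P : lmodType {ideal_quot K}) (P0 : lmodType Q) (j : P0 -> P) :
    restriction_iso (\pi_({ideal_quot K})%qT : {rmorphism Q -> {ideal_quot K}}) j ->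
    restriction_iso phi (j : P0 -> restr (quot_map (@princ_sub _ _ f)) P).
  move=> [bj jD jZ]; split=> // q x.
  by rewrite jZ -[RHS]/(quot_map _ (phi q) *: (j x : P)) quot_mapE.
have E := Ext_mx phi_surj phi_ker (restr_iso _ _ _ hM) (restr_iso _ _ _ hN) hD.
split=> h m.
  have [[|i] [mi hi]] := h m.+1; first by [].
  by exists i => //; apply/E.
by have [i mi hi] := h m; exists i.+1; split; [apply: leqW|apply/E].
Qed.

Variable n : idealr Q.
Hypotheses (noethQ : noetherian Q) (locQ : local_ring n).
Variables (I : idealr Q) (M N : lmodType {ideal_quot I}).
Hypotheses (fgM : fin_gen M) (fgN : fin_gen N).

Let noethQ' : noetherian_mod Q^o := noetherian_ring noethQ.

Lemma over_Q_iso (P : lmodType {ideal_quot I}) :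
  restriction_iso (\pi_({ideal_quot I})%qT : {rmorphism Q -> {ideal_quot I}})
    (id : over_Q P -> P).
Proof. by split=> //; exists id. Qed.

Lemma over_Q_kill (P : lmodType {ideal_quot I}) a (x : over_Q P) :
  a \in I -> a *: x = 0.
Proof.
move=> aI; rewrite -[LHS]/((\pi_({ideal_quot I})%qT a) *: (x : P)).
suff -> : (\pi_({ideal_quot I}) a)%qT = 0 by rewrite scale0r.
rewrite -(rmorph0 (\pi_({ideal_quot I})%qT)); apply/eqP.
by rewrite -Quotient.idealrBE subr0.
Qed.

Lemma over_Q_fin_gen (P : lmodType {ideal_quot I}) : fin_gen P -> fin_gen (over_Q P).
Proof.
move=> [s hs]; exists s => x; have [a ->] := hs x.
exists (fun i => repr (a i)); apply: eq_bigr => i _.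
by rewrite -[RHS]/((\pi_({ideal_quot I})%qT (repr (a i))) *: (s`_i : P)) reprK.
Qed.

Lemma principal_sub (f : ideal_elt I) a : principal (ideal_val f) a -> a \in I.
Proof. by move=> [q /subr0_eq ->]; apply/idealMr/ideal_valP. Qed.

Lemma hypersurface_resolution (f : ideal_elt I) : exists r D e,
  @mx_resolution Q (principal (ideal_val f)) (over_Q M) r D e.
Proof.
apply: mx_resolution_exists => //; first exact/add_gen_ideal/ideal_zero.
  exact: over_Q_fin_gen.
by move=> a x /principal_sub; apply: over_Q_kill.
Qed.

(** The same resolution by matrices modulo f computes both sides. *)
Lemma infinite_ext_incl (J : idealr Q) (JI : {subset J <= I}) (f : ideal_elt J) :
  infinite_ext (restr (quot_map JI) M) (restr (quot_map JI) N) f <->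
  infinite_ext M N (ideal_incl JI f).
Proof.
have [r [D [e hD]]] := hypersurface_resolution (ideal_incl JI f).
rewrite (infinite_ext_mx (over_Q_iso M) (over_Q_iso N) hD).
have iso (P : lmodType {ideal_quot I}) :
    restriction_iso (\pi_({ideal_quot J})%qT : {rmorphism Q -> {ideal_quot J}})
      (id : over_Q P -> restr (quot_map JI) P).
  split=> //; first by exists id.
  move=> q x.
  by rewrite -[RHS]/(quot_map _ (\pi_({ideal_quot J})%qT q) *: (x : P)) quot_mapE.
exact: (infinite_ext_mx (iso M) (iso N) hD).
Qed.

Lemma infinite_ext_unit (f f' : ideal_elt I) u v :
  v * u = 1 -> ideal_val f' = u * ideal_val f ->
  infinite_ext M N f' -> infinite_ext M N f.
Proof.
move=> vu f'E; have [r [D [e hD]]] := hypersurface_resolution f.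
rewrite (infinite_ext_mx (over_Q_iso M) (over_Q_iso N) hD).
rewrite (infinite_ext_mx (r := r) (D := D) (e := e) (over_Q_iso M) (over_Q_iso N)) //.
suff -> : principal (ideal_val f') = principal (ideal_val f) by [].
rewrite f'E; apply/funext => y; apply/propext.
split=> -[q /subr0_eq ->]; first by exists (q * u); ring.
by exists (q * v); rewrite -[X in X - _]mulr1 -vu; ring.
Qed.

Lemma infinite_ext_step (f f' : ideal_elt I) h x :
  h \in I -> x \in n -> ideal_val f' = ideal_val f + x * h ->
  nonzerodivisor (fun y => y = 0) (ideal_val f) ->
  nonzerodivisor (principal (ideal_val f)) h ->
  nonzerodivisor (principal (ideal_val f')) h ->
  infinite_ext M N f' -> infinite_ext M N f.
Proof.
move=> hI xn f'E nzf nzh nzh'.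
have fI := ideal_valP f.
have [r [D [e [r' [D' [e' [hD hD' ex]]]]]]] :
  exists r D e r' D' e',
    [/\ @mx_resolution Q (principal (ideal_val f)) (over_Q M) r D e,
        @mx_resolution Q (principal (ideal_val f')) (over_Q M) r' D' e'
      & forall k, (forall i, (k <= i)%N -> mx_exact (over_Q N) D i) ->
                  (forall i, (k <= i)%N -> mx_exact (over_Q N) D' i)].
  rewrite f'E; apply: hypersurface_step => //; rewrite -?f'E //.
  - exact: over_Q_fin_gen.
  - exact: over_Q_fin_gen.
  - by move=> y; apply: over_Q_kill.
  - by move=> y; apply: over_Q_kill.
  - by move=> y; apply: over_Q_kill.
  - by move=> y; apply: over_Q_kill.
  exact: local_jacobson xn.
rewrite (infinite_ext_mx (over_Q_iso M) (over_Q_iso N) hD).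
rewrite (infinite_ext_mx (over_Q_iso M) (over_Q_iso N) hD').
move=> inf m; apply: contrapT => nex.
have [i mi] := inf m; apply; apply: (ex m) mi => j mj.
by apply: contrapT => nj; apply: nex; exists j.
Qed.

Variable s : seq Q.
Hypotheses (hs : regular_seq s) (hI : generated_by I s).

Lemma gen_mem (j : 'I_(size s)) : s`_j \in I.
Proof. by apply/hI/(@mem_span Q Q^o)/mem_nth. Qed.

Lemma comb_mem (a : 'I_(size s) -> Q) : \sum_j a j * s`_j \in I.
Proof. by apply/hI; exists a. Qed.

Definition comb a : ideal_elt I := IdealElt (comb_mem a).

Lemma combP (f : ideal_elt I) : exists a, f = comb a.
Proof. by have /hI[a fE] := ideal_valP f; exists a; apply: val_inj. Qed.

Lemma cls_comb_eq0 a : (forall j, a j \in n) -> cls n (comb a) = 0.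
Proof.
move=> an; have <- : cls n (0 : ideal_elt I) = 0 by rewrite /cls /class raddf0.
apply/eqP; rewrite /cls class_eq subr0; apply/asboolP.
exists (size s), a, (fun j => IdealElt (gen_mem j)); split=> //.
by apply: val_inj; rewrite /= ideal_val_sum.
Qed.

Lemma cls_comb_eq (f f' : ideal_elt I) a : f = comb a -> cls n f = cls n f' ->
  exists2 a', f' = comb a' & forall j, a j - a' j \in n.
Proof.
move=> fE /eqP; rewrite /cls class_eq => /asboolP[r [b [y [bn _ /(congr1 val)]]]].
rewrite [RHS]ideal_val_sum /= => ff'.
have ex i : exists c : 'I_(size s) -> Q, ideal_val (y i) = \sum_j c j * s`_j.
  by have /hI[c ->] := ideal_valP (y i); exists c.
have [c hc] := choice ex.
exists (fun j => a j - \sum_i b i * c i j); last first.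
  move=> j; rewrite opprB addrC subrK rpred_sum // => i _.
  by rewrite mulrC; apply: idealMr.
apply: val_inj; rewrite /= -(subKr (ideal_val f) (ideal_val f')) ff' fE /=.
under [RHS]eq_bigr do rewrite mulrBl.
rewrite sumrB; congr (_ - _); under eq_bigr do rewrite hc mulr_sumr.
rewrite exchange_big; apply: eq_bigr => j _; rewrite mulr_suml.
by apply: eq_bigr => i _; rewrite mulrA.
Qed.

(** The coefficients are changed one at a time.  First f' is scaled so that
    its unit coefficient i0 becomes that of f; at each other index the change is
    a step f -> f + x h with h = s_k. *)
Lemma infinite_ext_cls (f f' : ideal_elt I) :
  cls n f = cls n f' -> cls n f != 0 -> infinite_ext M N f' -> infinite_ext M N f.
Proof.
move=> ff' f0; have [a fE] := combP f.
have [a' f'E aa'] := cls_comb_eq fE ff'.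
have [i0 ai0] : exists i0, a i0 \notin n.
  apply: contrapT => na; move: f0; rewrite fE cls_comb_eq0 ?eqxx // => j.
  by apply: contrapT => /negP aj; apply: na; exists j.
have [v va] := local_unit noethQ locQ ai0.
have [v' va'] : exists v', v' * a' i0 = 1.
  apply: (local_unit noethQ locQ); apply: contra ai0 => a'n.
  by rewrite -(subrK (a' i0) (a i0)) rpredD.
(* the coefficients of a unit multiple of f', equal to a at i0 *)
pose a'' j := (a i0 * v') * a' j.
have a''i0 : a'' i0 = a i0 by rewrite /a'' -mulrA va' mulr1.
have aa'' j : a'' j - a j \in n.
  have -> : a'' j - a j = (a' j * v') * (a i0 - a' i0) + (v' * a' i0 - 1) * a' j
      - (a j - a' j) by rewrite /a''; ring.
  by rewrite va' subrr mul0r addr0 rpredB // idealMr.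
have u1 : (v * a' i0) * (a i0 * v') = 1.
  by rewrite mulrACA va mul1r mulrC.
pose b k (j : 'I_(size s)) := if (j < k)%N then a'' j else a j.
(* b k has passed from a to a'' at the indices below k *)
suff steps k : (k <= size s)%N -> infinite_ext M N (comb (b k)) ->
    infinite_ext M N (comb (b 0%N)).
  move=> inf'; have -> : f = comb (b 0%N).
    by rewrite fE; apply: val_inj; apply: eq_bigr.
  apply: (steps (size s) (leqnn _)).
  apply: (infinite_ext_unit (f := comb (b (size s))) (f' := f') (u := v * a' i0)
    (v := a i0 * v')) inf'; first by rewrite mulrC.
  rewrite f'E /= mulr_sumr; apply: eq_bigr => j _.
  by rewrite /b ltn_ord mulrA [v * _ * _]mulrA u1 mul1r.
have hreg := regular_seq_mod hs; have zI := ideal_zero Q.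
have js x : x \in s -> in_jacobson x.
  move=> xs; apply: (local_jacobson noethQ locQ); apply: (ideal_local noethQ locQ (I := I)).
  exact/hI/(@mem_span Q Q^o).
elim: k => // k IH ks inf; apply: IH (ltnW ks) _.
pose k' := Ordinal ks; have bi0 l : b l i0 = a i0 by rewrite /b; case: ifP.
have bk j : b k.+1 j = b k j + (a'' k' - a k') * (j == k')%:R.
  rewrite /b ltnS leq_eqVlt -[j == k']/(j == k :> nat).
  have [jk|jk] := eqVneq (j : nat) k; last by rewrite mulr0 addr0.
  have -> : j = k' by apply: val_inj.
  by rewrite /= ltnn mulr1 addrC subrK.
have combS : ideal_val (comb (b k.+1)) =
    ideal_val (comb (b k)) + (a'' k' - a k') * s`_k'.
  rewrite /=; under eq_bigr do rewrite bk mulrDl.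
  rewrite big_split; congr (_ + _); rewrite /= (bigD1 k') //= eqxx mulr1.
  by rewrite big1 ?addr0 // => j /negbTE ->; rewrite mulr0 mul0r.
have [k0|k0] := eqVneq k' i0.
  suff <- : comb (b k.+1) = comb (b k) by [].
  by apply: val_inj; rewrite -[LHS]/(ideal_val _) combS k0 a''i0 subrr mul0r addr0.
have [|r [nzf [nzh _]]] :=
  regular_pair (b := b k) noethQ' zI js hreg k0 (v := v); first by rewrite bi0.
have [|r' [_ [nzh' _]]] :=
  regular_pair (b := b k.+1) noethQ' zI js hreg k0 (v := v); first by rewrite bi0.
exact: infinite_ext_step (gen_mem k') (aa'' k') combS nzf nzh nzh' inf.
Qed.

End Representatives.

Theorem theorem3p1
  (Q : comNzRingType) (n : idealr Q)
  (hQ : regular_local_ring n)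
  (hk : GRing.closed_field_axiom {ideal_quot n})
  (I : idealr Q) (hIn : {subset I <= @ideal_mul Q n Q^o n})
  (c : nat) (s : c.-tuple Q) (hs : regular_seq s) (hI : generated_by I s)
  (W : submodClosed (cotan n I))
  (J : idealr Q) (JI : {subset J <= I})
  (m : nat) (g : m.-tuple (ideal_elt I))
  (hW : is_basis W [seq cls n f | f <- g])
  (hg : regular_seq [seq ideal_val f | f <- g])
  (hJ : generated_by J [seq ideal_val f | f <- g])
  (M N : lmodType {ideal_quot I}) (hM : fin_gen M) (hN : fin_gen N) :
  cotan_map n JI @`
    support_variety n (restr (quot_map JI) M) (restr (quot_map JI) N)
  = support_variety n M N `&` [set v | v \in W].
Proof.
have [noethQ locQ _] := hQ; have [_ spanW] := hW.
have clsZ q (f : ideal_elt I) : cls n (q *: f) = \pi_({ideal_quot n})%qT q *: cls n f.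
  by rewrite -[RHS]/(red_scale _ _) red_scaleE.
have cls0 (K : idealr Q) : cls n (0 : ideal_elt K) = 0 by rewrite /cls /class raddf0.
have clsD (f f' : ideal_elt I) : cls n (f + f') = cls n f + cls n f'.
  exact: classD.
have map0 : cotan_map n JI 0 = 0.
  rewrite -(cls0 J) cotan_mapE -(cls0 I); congr (cls n _); exact: val_inj.
apply/seteqP; split=> [_ [v + <-]|v [vV vW]].
  move=> [[f [-> inf]]|->]; last first.
    by rewrite map0; split; [right|rewrite /= rpred0].
  rewrite cotan_mapE; split.
    left; exists (ideal_incl JI f); split=> //.
    exact: (infinite_ext_incl noethQ N hM JI f).1 inf.
  have [F] : exists2 F : ideal_elt I, ideal_val F = ideal_val f & cls n F \in W.
    have fs : in_span (map (@ideal_val Q I) g : seq Q^o) (ideal_val f).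
      exact/hJ/ideal_valP.
    apply: (span_min (P := fun y : Q^o =>
      exists2 F : ideal_elt I, ideal_val F = y & cls n F \in W) _ _ fs).
      split=> [|q _ _ [F <- FW] [G <- GW]].
        by exists 0; rewrite // cls0 rpred0.
      by exists (q *: F + G); rewrite // clsD clsZ rpredD // rpredZ.
    move=> _ /mapP[F Fg ->]; exists F => //.
    by apply/spanW/mem_span/map_f.
  by move=> FE FW; have -> : ideal_incl JI f = F by apply: val_inj.
have [f vE] : exists f : ideal_elt J, cls n (ideal_incl JI f) = v.
  have /spanW vs := vW.
  apply: (span_min (P := fun v => exists f : ideal_elt J,
    cls n (ideal_incl JI f) = v) _ _ vs).
    split=> [|q _ _ [F <-] [G <-]].
      by exists 0; rewrite -(cls0 I); congr (cls n _); apply: val_inj.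
    exists (repr q *: F + G); rewrite -{2}[q]reprK -clsZ -clsD; congr (cls n _).
    exact: val_inj.
  move=> _ /mapP[F Fg ->].
  have FJ : ideal_val F \in J by apply/hJ/(@mem_span Q Q^o)/map_f.
  by exists (IdealElt FJ); congr (cls n _); apply: val_inj.
have [->|v0] := eqVneq v 0; first by exists 0; [right|].
exists (cls n f); last by rewrite cotan_mapE.
left; exists f; split=> //; apply: (infinite_ext_incl noethQ N hM JI f).2.
case: vV => [[f' [vE' inf]]|/eqP]; last by rewrite (negbTE v0).
by apply: (infinite_ext_cls noethQ locQ hM hN hs hI _ _ inf); rewrite vE.
Qed.
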